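(* Let $\beta\in(0,1)$ and $1\le p<n/\beta$. Then the following statements are equivalent. 1. For all $f\in C_0^\infty(\mathbb{R}^n)$: $$\left(\int_0^\infty V(O_t(f))^{\frac{n-p\beta}{n}}\,d(t^p)\right)^{1/p}\lesssim\|f\|_{\dot{\Lambda}^{p,p}_\beta(\mathbb{R}^n)}.$$ 2. For all $f\in C_0^\infty(\mathbb{R}^n)$: $$\left(\int_{\mathbb{R}^n}|f(x)|^{\frac{np}{n-p\beta}}dx\right)^{\frac{n-p\beta}{np}}\lesssim\|f\|_{\dot{\Lambda}^{p,p}_\beta(\mathbb{R}^n)}.$$ 3. For all $f\in C_0^\infty(\mathbb{R}^n)$: $$\left(\int_{\mathbb{R}^n}\frac{|f(x)|^p}{|x|^{p\beta}}dx\right)^{1/p}\lesssim\|f\|_{\dot{\Lambda}^{p,p}_\beta(\mathbb{R}^n)}.$$ 4. For every bounded domain $O\subset\mathbb{R}^n$ with $C^\infty$ boundary: $$V(O)^{\frac{n-p\beta}{n}}\lesssim C^{p,p}_\beta(\overline{O}).$$ Moreover, all four inequalities hold.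
   Context: $C_0^\infty(\mathbb{R}^n)$ is the space of compactly supported smooth functions, $V$ is Lebesgue measure on $\mathbb{R}^n$, $O_t(f)=\{x:|f(x)|>t\}$, and $1_E$ is the characteristic function of $E$. Implicit constants are independent of $f$ and $O$. Besov norm: let $k=1+\lfloor\beta\rfloor$, $\Delta^1_h f(x)=f(x+h)-f(x)$ and $\Delta^k_h=\Delta^1_h\Delta^{k-1}_h$. Then $$\|f\|_{\dot{\Lambda}^{p,q}_\beta(\mathbb{R}^n)}=\left(\int_{\mathbb{R}^n}\|\Delta^k_h f\|_{L^p}^q|h|^{-(n+\beta q)}dh\right)^{1/q}.$$ Besov capacity: for compact $K$, $$C^{p,q}_\beta(K)=\inf\{\|f\|^p_{\dot{\Lambda}^{p,q}_\beta}: f\in C_0^\infty(\mathbb{R}^n),\ f\ge 1_K\}.$$ For arbitrary $E$, $$C^{p,q}_\beta(E)=\inf_{O\supseteq E\text{ open}}\sup_{K\subseteq O\text{ compact}}C^{p,q}_\beta(K).$$ *)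

(* Defs.v *)
From HB Require Import structures.
From mathcomp Require Import all_boot all_order all_algebra.
From mathcomp Require Import all_classical all_reals all_analysis.
Set Implicit Arguments. Unset Strict Implicit. Unset Printing Implicit Defensive.
Import Order.TTheory GRing.Theory Num.Theory.
Import numFieldNormedType.Exports.
Local Open Scope classical_set_scope.
Local Open Scope ring_scope.

Section Defs.
Variable R : realType.

Definition enorm n (x : 'rV[R]_n) : R := Num.sqrt (\sum_i x 0 i ^+ 2).

Definition edot n (x y : 'rV[R]_n) : R := \sum_i x 0 i * y 0 i.

(* Lebesgue integral of a nonnegative function on R^n, as the iterated
   integral of one-dimensional Lebesgue integrals (Tonelli). *)
Fixpoint iint (n : nat) : ('rV[R]_n -> \bar R) -> \bar R :=
  match n return ('rV[R]_n -> \bar R) -> \bar R with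
  | 0 => fun f => f 0
  | m.+1 => fun f =>
      (\int[@lebesgue_measure R]_(x in [set: R])
         iint (fun y : 'rV[R]_m => f (row_mx (\row_(j < 1) x) y)))%E
  end.

Definition vol n (E : set 'rV[R]_n) : \bar R := iint (fun x => (\1_E x)%:E).

Definition iterD n (vs : seq 'rV[R]_n) (f : 'rV[R]_n -> R) : 'rV[R]_n -> R :=
  foldr (fun v g => fun x => derive g x v) f vs.

Definition smooth n (f : 'rV[R]_n -> R) : Prop :=
  forall vs : seq 'rV[R]_n,
    continuous (iterD vs f) /\ forall x v, derivable (iterD vs f) x v.

Definition C0inf n (f : 'rV[R]_n -> R) : Prop :=
  smooth f /\ exists K : set 'rV[R]_n, compact K /\ forall x, ~ K x -> f x = 0.

Fixpoint Delta n (k : nat) (h : 'rV[R]_n) (f : 'rV[R]_n -> R) : 'rV[R]_n -> R :=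
  match k with
  | 0 => f
  | k'.+1 => fun x => Delta k' h f (x + h) - Delta k' h f x
  end.

Definition Lpnorm n (p : R) (g : 'rV[R]_n -> R) : \bar R :=
  poweR (iint (fun x => ((`|g x|) `^ p)%:E)) p^-1.

Definition besov n (p q beta : R) (f : 'rV[R]_n -> R) : \bar R :=
  let k := (Num.floor beta + 1)%R in
  poweR (iint (fun h => (poweR (Lpnorm p (Delta `|k|%N h f)) q
                          * ((enorm h) `^ (- (n%:R + beta * q)))%:E)%E)) q^-1.

Definition capK n (p q beta : R) (K : set 'rV[R]_n) : \bar R :=
  ereal_inf [set poweR (besov p q beta f) p | f in
               [set f | C0inf f /\ forall x, (\1_K x <= f x)%R]].

Definition cap n (p q beta : R) (E : set 'rV[R]_n) : \bar R :=
  ereal_inf [set ereal_sup [set capK p q beta K | K in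
                              [set K | compact K /\ K `<=` O]]
            | O in [set O | open O /\ E `<=` O]].

Definition levelset n (f : 'rV[R]_n -> R) (t : R) : set 'rV[R]_n :=
  [set x | t < `|f x|].

(* bounded domain with C^infinity boundary: O nonempty, open, connected,
   bounded, and near each boundary point, after a rigid rotation, O is the
   region above the graph of a C^infinity function.  The rotated last
   coordinate axis is the unit vector nu, and the graph function gamma is
   a smooth function on R^n that does not depend on the nu-coordinate. *)
Definition smooth_bounded_domain n (O : set 'rV[R]_n) : Prop :=
  [/\ O !=set0, open O, connected O,
      (exists M : R, forall x, O x -> enorm x <= M) &
      forall x0, closure O x0 -> ~ O x0 ->
        exists r : R, exists nu : 'rV[R]_n, exists gamma : 'rV[R]_n -> R,
          [/\ 0 < r, enorm nu = 1, smooth gamma,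
              (forall y (t : R), gamma (y + t *: nu) = gamma y) &
              forall x, enorm (x - x0) < r ->
                (O x <-> gamma x < edot x nu)]].

End Defs.

(* Main.v *)
(** The heart of the matter is the strong (Lorentz) form of inequality (1), from
which the others follow.  Put [m t = |{|f| > t}|] and [th = p beta / n].

A set of finite volume fills at most half of a cube of twice its volume, whence
[\int_{x + h \notin E} |h|^-(n + p beta) dh >= c |E|^-th] for every [x].
Since [|a - b|^p] dominates, up to a factor [p], the [p t^(p-1) dt]-measure of
the [t] with [|b| <= t < |a| / 2], Tonelli's theorem bounds the Besov energy
from below by a multiple of [J = \int m(2t) m(t)^-th p t^(p-1) dt].  The integral
[A = \int m(t)^(1-th) p t^(p-1) dt] of (1) is rescaled by [t -> 2t] and
[m(2t)^(1-th)] is split as [C m(2t) m(t)^-th + eps m(t)^(1-th)]; as [A] is finite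
for a test function, the second term is absorbed and [A <= C J].

For (2), monotonicity of [m] gives [t^p m(t)^(1-th) <= 2^p A], which is used to
bound [\int t^(q-1) m(t) dt] with [q = p / (1-th)].  For (3), one has
[\int_E |x|^-(p beta) dx <= C |E|^(1-th)].  Finally (4) is (2) applied to the
functions that are at least 1 on the compact set [closure O]. *)

Require Import Defs.
From HB Require Import structures.
From mathcomp Require Import all_boot all_order all_algebra.
From mathcomp Require Import all_classical all_reals all_analysis.
From mathcomp Require Import measurable_realfun.
From mathcomp Require Import ring lra.
Set Implicit Arguments. Unset Strict Implicit. Unset Printing Implicit Defensive.
Import Order.TTheory GRing.Theory Num.Theory.
Import numFieldNormedType.Exports.
Local Open Scope classical_set_scope.
Local Open Scope ring_scope.

(** * Measurability on row vectors *)

Section RowMeasurable.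
Variables (R : realType) (n : nat).

(** Generators of the product sigma-algebra. With this choice a map into row vectors is measurable
    as soon as its coordinates are, and openness is linked to it afterwards. *)
Definition coord_preimages : set (set 'rV[R]_n) :=
  [set B | exists i (A : set R), measurable A /\ B = (fun x : 'rV[R]_n => x 0 i) @^-1` A].

HB.instance Definition _ := @isMeasurable.Build (sigma_display coord_preimages)
  'rV[R]_n <<s coord_preimages >>
  (@sigma_algebra0 _ setT coord_preimages) (@sigma_algebraC _ coord_preimages)
  (@sigma_algebra_bigcup _ setT coord_preimages).

Lemma measurable_coord (i : 'I_n) : measurable_fun setT (fun x : 'rV[R]_n => x 0 i).
Proof.
by move=> _ A mA; rewrite setTI; apply: sub_sigma_algebra; exists i, A.
Qed.

Lemma measurable_rowP d (T : measurableType d) (f : T -> 'rV[R]_n) :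
  measurable_fun setT f <-> forall i, measurable_fun setT (fun t => f t 0 i).
Proof.
split=> [mf i|mf]; first exact: measurableT_comp (measurable_coord i) mf.
apply: (measurability coord_preimages) => // _ [_ [i [A [mA ->]]] <-].
exact: mf.
Qed.

Lemma measurable_addrow :
  measurable_fun setT (fun z : 'rV[R]_n * 'rV[R]_n => z.1 + z.2).
Proof.
apply/measurable_rowP => i; under eq_fun do rewrite mxE.
apply: measurable_funD.
  exact: (measurableT_comp (measurable_coord i)).
exact: (measurableT_comp (measurable_coord i)).
Qed.

Lemma measurable_enorm : measurable_fun setT (@enorm R n).
Proof.
rewrite (_ : @enorm R n = (@powR R ^~ 2^-1) \o (fun x => \sum_i x 0 i ^+ 2)).
  apply: (measurableT_comp (@measurable_powR R _)); apply: measurable_sum => i.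
  by apply: measurable_funX; exact: measurable_coord.
apply/funext => x /=; rewrite /enorm powR12_sqrt//.
by apply: sumr_ge0 => i _; rewrite sqr_ge0.
Qed.

(* An open set is the union of the balls it contains whose centre and radius
   are rational. *)
Lemma open_measurable_row (U : set 'rV[R]_n) : open U -> measurable U.
Proof.
move=> oU.
pose cube (q : 'rV[rat]_n * rat) : set 'rV[R]_n :=
  [set x | forall i, `|ratr (q.1 0 i) - x 0 i| < ratr q.2].
have -> : U = \bigcup_(q in [set q | cube q `<=` U]) cube q.
  apply/seteqP; split=> [x Ux|x [q /= qU qx]]; last exact: qU.
  have /nbhs_ballP[e /= e0 eU] : nbhs x U by exact: open_nbhs_nbhs.
  (* With a radius below e/2, any two points of one cube are less than e apart. *)
  have [r /andP[r0 re]] : exists r : rat, 0 < (ratr r : R) < e / 2.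
    have /rat_in_itvoo[r] : 0 < e / 2 by rewrite divr_gt0.
    by rewrite in_itv/= => ?; exists r.
  have /choice[q qP] : forall i, exists q : rat, `|ratr q - x 0 i| < (ratr r : R).
    move=> i; have /rat_in_itvoo[q] : x 0 i - ratr r < x 0 i + ratr r.
      by rewrite ltrD2l gtrN.
    by rewrite in_itv/= => qi; exists q; rewrite ltr_distl.
  exists (\row_i q i, r) => [y /= qy|i]; last by rewrite /= mxE.
  apply: eU; split=> // i j; rewrite (ord1 i).
  have := qP j; have := qy j; rewrite !mxE /ball/= => h1 h2.
  have -> : x 0 j - y 0 j = (ratr (q j) - y 0 j) - (ratr (q j) - x 0 j) by ring.
  rewrite (le_lt_trans (ler_normB _ _))//; lra.
rewrite bigcup_mkcond; apply: countable_bigcupT_measurable => // q.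
case: ifPn => // _.
have -> : cube q = \bigcap_(i in [set: 'I_n])
    (fun x : 'rV[R]_n => x 0 i) @^-1` [set y | `|ratr (q.1 0 i) - y| < ratr q.2].
  by apply/seteqP; split=> x /= qx i; [move=> _; exact: qx|exact: (qx i)].
apply: fin_bigcap_measurable => // i _; rewrite -[X in measurable X]setTI.
apply: measurable_coord => //.
have -> : [set y : R | `|ratr (q.1 0 i) - y| < ratr q.2] = ball (ratr (q.1 0 i) : R) (ratr q.2).
  by [].
exact: measurable_ball.
Qed.

Lemma continuous_measurable_row (f : 'rV[R]_n -> R) :
  continuous f -> measurable_fun setT f.
Proof.
move=> /continuousP cf; apply: (measurability _ (RGenOpens.measurableE R)).
move=> _ [_ [a [b ->]] <-]; rewrite setTI.
by apply: open_measurable_row; apply: cf; exact: interval_open.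
Qed.
End RowMeasurable.

Lemma measurable_row_mx (R : realType) m d (T : measurableType d)
    (f : T -> R) (g : T -> 'rV[R]_m) :
  measurable_fun setT f -> measurable_fun setT g ->
  measurable_fun setT (fun t => row_mx (\row_(j < 1) f t) (g t)).
Proof.
move=> mf mg; apply/measurable_rowP => i; under eq_fun do rewrite mxE.
case: (fintype.split i) => j; first by under eq_fun do rewrite mxE; exact: mf.
exact: (measurableT_comp (measurable_coord j)).
Qed.

(** * The iterated integral as integration against a measure *)

Lemma sigma_finite_pushforward d1 d2 (T1 : measurableType d1)
    (T2 : measurableType d2) (R : realType)
    (m : {measure set T1 -> \bar R}) (phi : T1 -> T2) (psi : T2 -> T1) :
  sigma_finite setT m ->
  measurable_fun setT phi -> measurable_fun setT psi -> cancel phi psi ->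
  exists m' : {sigma_finite_measure set T2 -> \bar R},
    forall f, measurable_fun setT f -> (forall x, 0 <= f x)%E ->
      (\int[m']_x f x = \int[m]_x f (phi x))%E.
Proof.
move=> [F FT Ffin] mphi mpsi phiK.
pose pm : {measure set T2 -> \bar R} :=
  measure_function_pushforward__canonical__measure_function_Measure m mphi.
have fin : sigma_finite setT pm.
  exists (fun i => psi @^-1` F i); first by rewrite -preimage_bigcup -FT preimage_setT.
  move=> i; have [mF Fo] := Ffin i; split.
    by rewrite -[X in measurable X]setTI; exact: mpsi.
  rewrite /= /pushforward (_ : _ @^-1` _ = F i)//.
  by apply/seteqP; split=> z /=; rewrite phiK.
pose mx := Measure_isSigmaFinite.Build _ _ _ pm fin.
exists (HB.pack_for {sigma_finite_measure set T2 -> \bar R}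
  (pm : set _ -> \bar R) (Measure.class pm) mx) => f mf f0.
by rewrite (ge0_integral_pushforward mphi).
Qed.

(* The product of sigma-finite measures has no usable canonical structure of
   sigma-finite measure: the one for subprobabilities takes precedence. *)
Lemma sigma_finite_pushforward_prod d1 d2 d (T1 : measurableType d1)
    (T2 : measurableType d2) (T : measurableType d) (R : realType)
    (m1 : {sigma_finite_measure set T1 -> \bar R})
    (m2 : {sigma_finite_measure set T2 -> \bar R})
    (phi : T1 * T2 -> T) (psi : T -> T1 * T2) :
  measurable_fun setT phi -> measurable_fun setT psi -> cancel phi psi ->
  exists m : {sigma_finite_measure set T -> \bar R},
    forall f, measurable_fun setT f -> (forall x, 0 <= f x)%E ->
      (\int[m]_x f x = \int[m1]_x \int[m2]_y f (phi (x, y)))%E.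
Proof.
move=> mphi mpsi phiK.
have fin : sigma_finite setT (m1 \x m2)%E.
  have /sigma_finiteP[F [TF ndF Foo]] := sigma_finiteT m1.
  have /sigma_finiteP[G [TG ndG Goo]] := sigma_finiteT m2.
  (* Both exhaustions increase, so the rectangles with equal indices already cover the product. *)
  exists (fun n => F n `*` G n).
    apply/seteqP; split=> // -[x y] _.
    have [n _ Fnx] : (\bigcup_i F i) x by rewrite -TF.
    have [k _ Gky] : (\bigcup_i G i) y by rewrite -TG.
    exists (maxn n k) => //; split=> /=.
    - by move: x Fnx; exact/subsetPset/ndF/leq_maxl.
    - by move: y Gky; exact/subsetPset/ndG/leq_maxr.
  move=> k; have [mF Fk] := Foo k; have [mG Gk] := Goo k.
  split; first exact: measurableX.
  by rewrite product_measure1E// lte_mul_pinfty// ge0_fin_numE.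
have [m mE] := sigma_finite_pushforward fin mphi mpsi phiK.
exists m => f mf f0; rewrite mE// fubini_tonelli1//.
exact: measurableT_comp.
Qed.

Section IteratedIntegral.
Variable R : realType.

(** The measure follows the recursion of [iint]: a Dirac mass in dimension 0, then the image of
    Lebesgue measure times the previous measure under concatenation. Sigma-finiteness is carried
    along so that Tonelli's theorem applies to [iint]. *)
Lemma iint_integralE n : exists mu : {sigma_finite_measure set 'rV[R]_n -> \bar R},
  forall f, measurable_fun setT f -> (forall x, 0 <= f x)%E ->
    iint f = (\int[mu]_x f x)%E.
Proof.
elim: n => [|n [mu muE]].
  have fin : sigma_finite setT (@dirac _ 'rV[R]_0 0 R).
    by apply: fin_num_fun_sigma_finite => [|A mA]; rewrite ?measure0// diracE.
  pose mx := Measure_isSigmaFinite.Build _ _ _ (@dirac _ 'rV[R]_0 0 R) fin.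
  exists (HB.pack_for {sigma_finite_measure set 'rV[R]_0 -> \bar R}
    (@dirac _ 'rV[R]_0 0 R) mx) => f mf f0 /=.
  by rewrite integral_dirac// diracT mul1e.
pose rm (z : measurableTypeR R * 'rV[R]_n) : 'rV[R]_n.+1 := row_mx (\row_(j < 1) z.1) z.2.
have mrm : measurable_fun setT rm by apply: measurable_row_mx.
pose tl (x : 'rV[R]_n.+1) : measurableTypeR R * 'rV[R]_n := (x 0 0, \row_j x 0 (lift ord0 j)).
have mtl : measurable_fun setT tl.
  apply: measurable_fun_pair; first exact: measurable_coord.
  apply/measurable_rowP => i; under eq_fun do rewrite mxE.
  exact: measurable_coord.
have rmK : cancel rm tl.
  case=> x y; rewrite /tl /rm; congr pair.
    by rewrite mxE; case: fintype.splitP => //= j _; rewrite mxE.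
  apply/rowP => j; rewrite !mxE; case: fintype.splitP => /= k.
    by rewrite (ord1 k).
  by rewrite /bump add1n add1n => -[jk]; congr (y _ _); apply/val_inj.
have [mu' mu'E] := sigma_finite_pushforward_prod (@lebesgue_measure R) mu mrm mtl rmK.
exists mu' => f mf f0; rewrite mu'E//=.
apply: eq_integral => x _; rewrite muE//.
by apply: measurableT_comp mf _; apply: measurable_row_mx.
Qed.

(** Lebesgue measure on R^n, selected by choice; everything about it is deduced from [iintE]. *)
Definition rowmeasure n : {sigma_finite_measure set 'rV[R]_n -> \bar R} :=
  sval (cid (iint_integralE n)).

Lemma iintE n (f : 'rV[R]_n -> \bar R) : measurable_fun setT f ->
  (forall x, 0 <= f x)%E -> iint f = (\int[rowmeasure n]_x f x)%E.
Proof. exact: svalP (cid (iint_integralE n)) f. Qed.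

Lemma volE n (E : set 'rV[R]_n) : measurable E -> vol E = rowmeasure n E.
Proof.
move=> mE; rewrite /vol iintE ?integral_indic ?setIT//.
by apply/measurable_EFinP; exact: measurable_indic.
Qed.

End IteratedIntegral.

(** * Affine changes of variable and volumes of boxes *)

Section AffineChange.
Variable R : realType.
Local Notation leb := (@lebesgue_measure R).

(** Lebesgue measure equals [a] times its image under t -> a t + b, by uniqueness of the measure
    that gives half-open intervals their length. *)
Lemma ge0_integral_affine (a b : R) (g : R -> \bar R) : 0 < a ->
  measurable_fun setT g -> (forall t, 0 <= g t)%E ->
  (\int[leb]_t g (a * t + b)%R = a^-1%:E * \int[leb]_t g t)%E.
Proof.
move=> a0 mg g0.
pose phi (t : measurableTypeR R) : measurableTypeR R := a * t + b.
have mphi : measurable_fun setT phi.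
  by apply: measurable_funD => //; exact: measurable_funM.
pose pm : {measure set (measurableTypeR R) -> \bar R} :=
  measure_function_pushforward__canonical__measure_function_Measure leb mphi.
pose m' := mscale (NngNum (ltW a0)) pm.
have lebE A : measurable A -> leb A = m' A.
  apply: lebesgue_measure_unique => _ [[x y] _ <-].
  rewrite /= /m' /mscale /= /pushforward (_ : phi @^-1` _ = `](x - b) / a, (y - b) / a]%classic).
    rewrite !lebesgue_measure_itv/= !lte_fin ltr_pM2r ?invr_gt0// ltrD2r.
    case: ifPn => _; last by rewrite mule0.
    by rewrite -!EFinB -EFinM -mulrBl mulrCA divff ?gt_eqF// mulr1 opprB addrA subrK.
  by apply/seteqP; split=> t /=; rewrite !in_itv/= ltr_pdivrMr//
    ler_pdivlMr// ltrBlDr lerBrDr [t * a]mulrC.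
have -> : (\int[leb]_t g t = a%:E * \int[leb]_t g (phi t))%E.
  rewrite (eq_measure_integral m'); last by move=> A mA _; exact: lebE.
  by rewrite ge0_integral_mscale// (ge0_integral_pushforward mphi).
by rewrite muleA -EFinM mulVf ?gt_eqF// mul1e.
Qed.

(** Induction on the dimension: the first coordinate of [v] is absorbed by the one-dimensional
    change of variable with slope 1, the others by the induction hypothesis. *)
Lemma iint_shift n (f : 'rV[R]_n -> \bar R) (v : 'rV[R]_n) :
  measurable_fun setT f -> (forall x, 0 <= f x)%E ->
  iint (fun x => f (x + v)) = iint f.
Proof.
elim: n f v => [|n IH] f v mf f0 /=; first by rewrite (thinmx0 v) addr0.
pose w : 'rV[R]_n := \row_j v 0 (lift ord0 j).
have rowD x y : row_mx (\row_(j < 1) x) y + v = row_mx (\row_(j < 1) (x + v 0 0)) (y + w).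
  apply/rowP => j; rewrite !mxE; case: fintype.splitP => /= k jk.
    rewrite !mxE; congr (_ + v _ _); apply/val_inj; rewrite /= jk.
    by rewrite (ord1 k).
  by rewrite !mxE; congr (_ + v _ _); apply/val_inj; rewrite /= jk.
pose g x := iint (fun y : 'rV[R]_n => f (row_mx (\row_(j < 1) x) y)).
have mfx x : measurable_fun setT (fun y : 'rV[R]_n => f (row_mx (\row_(j < 1) x) y)).
  by apply: (measurableT_comp mf); apply: measurable_row_mx.
have gE x : g x = (\int[rowmeasure R n]_y f (row_mx (\row_(j < 1) x) y))%E.
  by rewrite /g iintE.
have mg : measurable_fun setT g.
  pose F (z : measurableTypeR R * 'rV[R]_n) := f (row_mx (\row_(j < 1) z.1) z.2).
  have mF : measurable_fun setT F.
    by apply: (measurableT_comp mf); apply: measurable_row_mx.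
  have F0 z : (0 <= F z)%E by exact: f0.
  rewrite (_ : g = fubini_F (rowmeasure R n) F); last by apply/funext => x; rewrite gE.
  exact: measurable_fun_fubini_tonelli_F.
have g0 x : (0 <= g x)%E by rewrite gE integral_ge0.
rewrite -[RHS]mul1e -invr1 -(@ge0_integral_affine 1 (v 0 0))//.
apply: eq_integral => x _; rewrite mul1r /g.
rewrite -(IH (fun y => f (row_mx (\row_(j < 1) (x + v 0 0)) y)) w)//.
by congr iint; apply/funext => y; rewrite rowD.
Qed.

Lemma vol_box n (a b : R) : a <= b ->
  vol [set x : 'rV[R]_n | forall i, a < x 0 i <= b] = ((b - a) ^+ n)%:E.
Proof.
move=> ab; rewrite /vol; elim: n => [|n IH] /=.
  by rewrite expr0 indicE mem_set//= => -[].
(* The slice over a first coordinate x is the box of one dimension less if x lies in ]a, b], and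
   empty otherwise. *)
have -> : (fun x => iint (fun y : 'rV[R]_n =>
    (\1_[set x : 'rV_n.+1 | forall i, a < x 0 i <= b] (row_mx (\row_(j < 1) x) y))%:E)) =
    (fun x => (\1_`]a, b] x)%:E * ((b - a) ^+ n)%:E)%E.
  apply/funext => x; rewrite -IH; have [xab|xab] := pselect (x \in `]a, b]).
    rewrite [in RHS]indicE mem_set//= mul1e; congr iint; apply/funext => y.
    rewrite !indicE; congr ((nat_of_bool _)%:R%:E); apply/asboolP/asboolP => /= H i.
      by have := H (lift ord0 i); rewrite mxE; case: fintype.splitP => /= k;
        [rewrite (ord1 k)|rewrite /bump add1n add1n => -[ik];
         rewrite (_ : k = i)//; apply/val_inj].
    by rewrite mxE; case: fintype.splitP => /= k _; rewrite ?mxE.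
  rewrite [in RHS]indicE memNset//= mul0e.
  rewrite (_ : (fun y : 'rV[R]_n => _) = cst 0%E); first by rewrite iintE// integral0.
  apply/funext => y /=; rewrite indicE memNset// => /(_ ord0).
  by rewrite mxE; case: fintype.splitP => /= k _ //; rewrite mxE.
rewrite ge0_integralZr//; last by rewrite lee_fin exprn_ge0// subr_ge0.
  by rewrite integral_indic// setIT /= lebesgue_measure_itv/= lte_fin;
    case: ltgtP ab => // [ab|<-] _; rewrite ?subrr ?mul0e ?expr0n//= -EFinB -EFinM exprS.
by apply/measurable_EFinP; exact: measurable_indic.
Qed.

End AffineChange.

(** * Layer cake and Tonelli *)

(** The integral of a nonnegative function is a supremum over the simple functions below it, hence
    monotone without measurability. This avoids many side conditions on slices and restricted
    integrands. *)
Lemma ge0_le_integral_nonmeas d (T : measurableType d) (R : realType)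
    (mu : {measure set T -> \bar R}) (D : set T) (f g : T -> \bar R) :
  (forall x, D x -> 0 <= f x)%E -> (forall x, D x -> f x <= g x)%E ->
  (\int[mu]_(x in D) f x <= \int[mu]_(x in D) g x)%E.
Proof.
move=> f0 fg; rewrite (integral_mkcond D f) (integral_mkcond D g).
have rf0 x : (0 <= (f \_ D) x)%E by rewrite patchE; case: ifPn => // /set_mem /f0.
have rfg x : ((f \_ D) x <= (g \_ D) x)%E by rewrite !patchE; case: ifPn => // /set_mem /fg.
rewrite !ge0_integralTE//; last by move=> x; exact: le_trans (rf0 x) (rfg x).
apply: le_ereal_sup => _ [h /= hf <-]; exists h => // x.
exact: le_trans (hf x) (rfg x).
Qed.

Lemma measurable_lt_set d (T : measurableType d) (R : realType) (f g : T -> R) :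
  measurable_fun setT f -> measurable_fun setT g -> measurable [set x | f x < g x].
Proof.
move=> mf mg; rewrite -[X in measurable X]setTI.
exact: (measurable_fun_ltr mf mg measurableT (Y := [set true])).
Qed.

Section Tonelli3.
Context d1 d2 d3 (T1 : measurableType d1) (T2 : measurableType d2)
  (T3 : measurableType d3) (R : realType).
Variables (m1 : {sigma_finite_measure set T1 -> \bar R})
  (m2 : {sigma_finite_measure set T2 -> \bar R})
  (m3 : {sigma_finite_measure set T3 -> \bar R}).

(** Three successive exchanges: b with c, a with c, a with b. For the energy bound this turns the
    order (level, point, increment) into its reverse. *)
Lemma tonelli_rev3 (F : T1 -> T2 -> T3 -> \bar R) :
  measurable_fun setT (fun z : T1 * T2 * T3 => F z.1.1 z.1.2 z.2) ->
  (forall a b c, 0 <= F a b c)%E ->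
  (\int[m1]_a \int[m2]_b \int[m3]_c F a b c =
   \int[m3]_c \int[m2]_b \int[m1]_a F a b c)%E.
Proof.
move=> mF F0.
have mF' d (T : measurableType d) (a : T -> T1) (b : T -> T2) (c : T -> T3) :
    measurable_fun setT a -> measurable_fun setT b -> measurable_fun setT c ->
    measurable_fun setT (fun t => F (a t) (b t) (c t)).
  move=> ma mb mc; apply: (measurableT_comp mF (g := fun t => (a t, b t, c t))).
  by apply: measurable_fun_pair => //; exact: measurable_fun_pair.
transitivity (\int[m1]_a \int[m3]_c \int[m2]_b F a b c)%E.
  apply: eq_integral => a _.
  apply: (fubini_tonelli (fun z : T2 * T3 => F a z.1 z.2)) => [|z]; last exact: F0.
  exact: mF'.
transitivity (\int[m3]_c \int[m1]_a \int[m2]_b F a b c)%E.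
  pose G (z : T1 * T3) := (\int[m2]_b F z.1 b z.2)%E.
  apply: (fubini_tonelli G) => [|z]; last by apply: integral_ge0.
  have := @measurable_fun_fubini_tonelli_F _ _ _ _ R m2
    (fun z : (T1 * T3) * T2 => F z.1.1 z.2 z.1.2); apply => [|z]; last exact: F0.
  by apply: mF' => //; exact: measurableT_comp.
apply: eq_integral => c _.
apply: (fubini_tonelli (fun z : T1 * T2 => F z.1 z.2 c)) => [|z]; last exact: F0.
exact: mF'.
Qed.

End Tonelli3.

Section LayerCake.
Context (R : realType).
Local Notation leb := (@lebesgue_measure R).

(** The interval ]c/2, c[ suffices: there t^(q-1) >= (c/2)^(q-1), so the integral is at least
    (c/2)^q. *)
Lemma powR_le_layer_cake (c q : R) : 0 <= c -> 1 <= q ->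
  ((c `^ q)%:E <= (2 `^ q)%:E *
     \int[leb]_t (if 0 < t < c then t `^ (q - 1) else 0)%:E)%E.
Proof.
move=> c0 q1; have q0 : 0 < q by lra.
have [->|cn0] := eqVneq c 0.
  rewrite powR0 ?gt_eqF//; apply: mule_ge0; rewrite ?lee_fin ?powR_ge0//.
  by apply: integral_ge0 => t _; rewrite lee_fin; case: ifP => // _; exact: powR_ge0.
have {cn0}c0 : 0 < c by rewrite lt_def cn0.
have -> : ((c `^ q)%:E =
    (2 `^ q)%:E * \int[leb]_(t in `](c / 2)%R, c%R[) ((c / 2) `^ (q - 1))%:E)%E.
  rewrite integral_cst//= lebesgue_measure_itv/= lte_fin gtr_pMr// invf_lt1// ltr1n.
  rewrite -EFinB -!EFinM (_ : c - c / 2 = c / 2); last by field.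
  by rewrite [X in _ * X]mulrC mulr_powRB1 ?divr_ge0 ?ltW// -powRM// ?divr_ge0 ?ltW// mulrC divfK.
apply: lee_wpmul2l; first by rewrite lee_fin powR_ge0.
rewrite integral_mkcond; apply: ge0_le_integral_nonmeas => t _; rewrite patchE.
  by case: ifPn => // _; rewrite lee_fin powR_ge0.
case: ifPn => [|_]; last by rewrite lee_fin; case: ifP => // _; exact: powR_ge0.
rewrite inE/= in_itv/= => /andP[ct tc].
have c20 : 0 < c / 2 by rewrite divr_gt0.
have t0 : 0 < t by exact: lt_trans ct.
by rewrite tc t0 lee_fin ge0_ler_powR ?nnegrE ?subr_ge0// ltW.
Qed.

Lemma integral_powR_le (c q : R) : 0 < c -> 1 <= q ->
  (\int[leb]_t (if 0 < t < c then t `^ (q - 1) else 0)%:E <= (c `^ q)%:E)%E.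
Proof.
move=> c0 q1.
have -> : ((c `^ q)%:E = \int[leb]_(t in `]0%R, c%R[) (c `^ (q - 1))%:E)%E.
  rewrite integral_cst//= lebesgue_measure_itv/= lte_fin c0 oppr0 adde0 -EFinM.
  by rewrite mulrC mulr_powRB1// ?(ltW c0)//; lra.
rewrite [leRHS]integral_mkcond; apply: ge0_le_integral_nonmeas => t _; rewrite ?patchE.
  by rewrite lee_fin; case: ifP => // _; exact: powR_ge0.
rewrite (_ : (t \in `]0, c[%classic) = (0 < t < c)); last first.
  by apply/idP/idP; rewrite inE/= in_itv.
case: ifPn => // /andP[t0 tc].
by rewrite lee_fin ge0_ler_powR ?nnegrE ?subr_ge0// ltW.
Qed.

Lemma ge0_integral_ioy (g : R -> \bar R) :
  (\int[leb]_(t in `]0%R, +oo[) g t = \int[leb]_t (if (0 < t)%R then g t else 0))%E.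
Proof.
rewrite integral_mkcond; apply: eq_integral => t _; rewrite patchE.
rewrite (_ : (t \in `]0%R, +oo[%classic) = (0 < t))//.
by apply/idP/idP; rewrite inE/= in_itv/= andbT.
Qed.

(** The pointwise bound at c = |f x|, followed by Tonelli. It serves with weight 1 for (2), with
    weight |x|^-(p beta) for (3), and with an indicator as weight for the bathtub inequality. *)
Lemma layer_cake d (T : measurableType d) (mu : {sigma_finite_measure set T -> \bar R})
    (f W : T -> R) (q : R) : measurable_fun setT f -> measurable_fun setT W ->
  (forall x, 0 <= W x) -> 1 <= q ->
  (\int[mu]_x (`|f x| `^ q * W x)%:E <= (2 `^ q)%:E *
    \int[leb]_(t in `]0%R, +oo[)
      ((t `^ (q - 1))%:E * \int[mu]_(x in [set x | t < `|f x|]%R) (W x)%:E))%E.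
Proof.
move=> mf mW W0 q1.
(* Both constraints on t are put into the integrand, so that Tonelli applies on the full product. *)
pose F (z : T * measurableTypeR R) : \bar R :=
  (if 0 < z.2 < `|f z.1| then z.2 `^ (q - 1) * W z.1 else 0)%:E.
have F0 z : (0 <= F z)%E.
  by rewrite lee_fin; case: ifP => // _; rewrite mulr_ge0 ?powR_ge0.
have mF : measurable_fun setT F.
  apply/measurable_EFinP; apply: measurable_fun_ifT => //.
    apply: measurable_and; apply: measurable_fun_ltr => //.
    by do 2 apply: measurableT_comp => //.
  apply: measurable_funM; last exact: measurableT_comp.
  exact: (measurableT_comp (@measurable_powR R _)).
apply: (@le_trans _ _ (\int[mu]_x ((2 `^ q)%:E * \int[leb]_t F (x, t)))%E).
  apply: ge0_le_integral_nonmeas => x _; first by rewrite lee_fin mulr_ge0 ?powR_ge0.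
  rewrite (_ : (\int[leb]_t F (x, t) =
      (\int[leb]_t (if 0 < t < `|f x| then t `^ (q - 1) else 0)%R%:E) * (W x)%:E)%E).
    rewrite muleA EFinM; apply: lee_wpmul2r; first by rewrite lee_fin.
    exact: powR_le_layer_cake.
  rewrite -ge0_integralZr ?lee_fin//.
  - apply: eq_integral => t _; rewrite /F/= -EFinM.
    by case: ifP => // _; rewrite mul0r.
  - apply/measurable_EFinP; apply: measurable_fun_ifT => //.
    by apply: measurable_and; exact: measurable_fun_ltr.
  - by move=> t _; rewrite lee_fin; case: ifP => // _; exact: powR_ge0.
rewrite ge0_integralZl ?lee_fin ?powR_ge0//; last 2 first.
  exact: (measurable_fun_fubini_tonelli_F F).
  by move=> x _; apply: integral_ge0.
rewrite (fubini_tonelli F)// ge0_integral_ioy.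
apply: lee_wpmul2l; first by rewrite lee_fin powR_ge0.
apply: ge0_le_integral_nonmeas => t _; first by apply: integral_ge0.
case: ifPn => t0; last first.
  by rewrite integral0_eq// => x _; rewrite /F/= (negbTE t0).
have mE : measurable [set x | t < `|f x|].
  by apply: measurable_lt_set => //; exact: measurableT_comp.
rewrite -ge0_integralZl//; [|by apply/measurable_EFinP; exact: measurable_funTS
  |by move=> x _; rewrite lee_fin|by rewrite lee_fin powR_ge0].
rewrite [leRHS]integral_mkcond; apply: ge0_le_integral_nonmeas => // x _.
rewrite patchE /F /= t0 /=; case: ifPn => [tf|_].
  by rewrite mem_set//.
by case: ifPn => // _; rewrite lee_fin mulr_ge0 ?powR_ge0.
Qed.
End LayerCake.

(** * One-dimensional inequalities for distribution functions *)

Section PowerInequalities.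
Context (R : realType).

Lemma ler_powRN (x y s : R) : 0 < x -> x <= y -> 0 <= s -> y `^ (- s) <= x `^ (- s).
Proof.
move=> x0 xy s0; have y0 : 0 < y by exact: lt_le_trans xy.
by rewrite !powRN lef_pV2 ?posrE ?powR_gt0// ge0_ler_powR// nnegrE ltW.
Qed.

(** If u >= dl v, then u^(-th) <= (dl v)^(-th) and the first term suffices; otherwise u^(1-th) <=
    (dl v)^(1-th). A small [dl] makes the second coefficient small enough for absorption. *)
Lemma powR_onem_split (th dl u v : R) : 0 < th < 1 -> 0 < dl -> 0 <= u -> u <= v ->
  u `^ (1 - th) <= dl `^ (- th) * (u * v `^ (- th)) + dl `^ (1 - th) * v `^ (1 - th).
Proof.
move=> /andP[th0 th1] dl0 u0 uv.
have [->|un0] := eqVneq u 0.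
  rewrite powR0 ?subr_eq0 ?gt_eqF// mul0r mulr0 add0r.
  by rewrite mulr_ge0 ?powR_ge0.
have {un0}u0 : 0 < u by rewrite lt_def un0.
have v0 : 0 < v by exact: lt_le_trans uv.
have [duv|uvd] := leP (dl * v) u.
  apply: ler_wpDr; first by rewrite mulr_ge0 ?powR_ge0.
  rewrite powRD ?(gt_eqF u0) ?implybT// (powRr1 (ltW u0)) mulrCA.
  rewrite (ler_pM2l u0) -powRM ?(ltW dl0) ?(ltW v0)//.
  by apply: ler_powRN => //; [rewrite mulr_gt0|rewrite ltW].
apply: ler_wpDl; first by rewrite !mulr_ge0 ?powR_ge0 ?(ltW u0).
rewrite -powRM ?(ltW dl0) ?(ltW v0)// ge0_ler_powR ?nnegrE ?subr_ge0
  ?(ltW th1) ?(ltW uvd) ?(ltW u0)//.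
by rewrite mulr_ge0 ?(ltW dl0) ?(ltW v0).
Qed.

End PowerInequalities.

Section DistributionFunction.
Context (R : realType).
Local Notation leb := (@lebesgue_measure R).
Variables (p th : R) (m : R -> R).
Hypotheses (p1 : 1 <= p) (th0 : 0 < th) (th1 : th < 1) (m0 : forall t, 0 <= m t)
  (mm : measurable_fun setT m) (m_ni : forall s t, 0 < s -> s <= t -> m t <= m s).

Let p0 : 0 < p. Proof. exact: lt_le_trans ltr01 p1. Qed.
(** The density of d(t^p). *)
Let w (t : R) := p * t `^ (p - 1).
Let w0 t : 0 <= w t. Proof. by rewrite mulr_ge0 ?powR_ge0 ?ltW. Qed.
Let mw : measurable_fun setT w.
Proof. exact: measurable_funM. Qed.

Let a t := m t `^ (1 - th) * w t.
Let a0 t : 0 <= a t. Proof. by rewrite mulr_ge0 ?powR_ge0. Qed.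
Let ma : measurable_fun setT a.
Proof.
apply: measurable_funM => //.
exact: (measurableT_comp (@measurable_powR R _)).
Qed.

Local Notation A := (\int[leb]_(t in `]0%R, +oo[) (m t `^ (1 - th) * w t)%:E)%E.

(** The integrand vanishes beyond [M] and is bounded on ]0, M[. This finiteness is what permits the
    later absorption. *)
Lemma weight_integral_lty (V M : R) :
  (forall t, 0 < t -> m t <= V) -> 0 < M -> (forall t, M <= t -> m t = 0) ->
  (A < +oo)%E.
Proof.
move=> mV M0 mM; have V0 : 0 <= V by exact: le_trans (m0 1) (mV _ ltr01).
apply: (@le_lt_trans _ _ (\int[leb]_(t in `]0%R, M[) (V `^ (1 - th) * (p * M `^ (p - 1)))%:E)%E).
  rewrite [leLHS]integral_mkcond [leRHS]integral_mkcond.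
  apply: ge0_le_integral_nonmeas => t _; rewrite !patchE.
    by case: ifPn => // _; rewrite lee_fin a0.
  case: ifPn => [|_]; last by case: ifPn => // _; rewrite lee_fin !mulr_ge0 ?powR_ge0 ?ltW.
  rewrite inE/= in_itv/= andbT => t0; case: ifPn => [|].
    rewrite inE/= in_itv/= t0/= => tM; rewrite lee_fin.
    apply: ler_pM; rewrite ?powR_ge0//.
      by rewrite ge0_ler_powR ?nnegrE ?subr_ge0 ?(ltW th1) ?mV.
    by rewrite ler_pM2l// ge0_ler_powR ?nnegrE ?subr_ge0 ?(ltW t0) ?(ltW M0) ?(ltW tM).
  rewrite notin_setE/= in_itv/= t0/= => /negP; rewrite -leNgt => Mt.
  by rewrite (mM _ Mt) powR0 ?mul0r// gt_eqF// subr_gt0.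
by rewrite integral_cst//= lebesgue_measure_itv/= lte_fin M0 -EFinB -EFinM ltry.
Qed.

(** On ]t/2, t[ the integrand is at least m(t)^(1-th) (t/2)^(p-1), as [m] is nonincreasing and p >=
    1. This is the passage from the strong to the weak-type bound. *)
Lemma weight_integral_ge (t : R) : 0 < t ->
  ((t `^ p * m t `^ (1 - th))%:E <= (2 `^ p)%:E * A)%E.
Proof.
move=> t0; have t20 : 0 < t / 2 by rewrite divr_gt0.
have -> : ((t `^ p * m t `^ (1 - th))%:E =
    (2 `^ p)%:E * \int[leb]_(s in `](t / 2)%R, t%R[) ((t / 2) `^ (p - 1) * m t `^ (1 - th))%:E)%E.
  rewrite integral_cst//= lebesgue_measure_itv/= lte_fin gtr_pMr// invf_lt1// ltr1n.
  rewrite -EFinB -!EFinM (_ : t - t / 2 = t / 2); last by field.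
  rewrite [X in 2 `^ p * X]mulrAC [_ * (t / 2)]mulrC mulr_powRB1 ?(ltW t20)//.
  by rewrite mulrA -powRM ?(ltW t20)// mulrCA divff// mulr1.
apply: lee_wpmul2l; first by rewrite lee_fin powR_ge0.
rewrite [leLHS]integral_mkcond [leRHS]integral_mkcond;
apply: ge0_le_integral_nonmeas => s _; rewrite !patchE.
  by case: ifPn => // _; rewrite lee_fin mulr_ge0 ?powR_ge0.
case: ifPn => [|_]; last by case: ifPn => // _; rewrite lee_fin a0.
rewrite inE/= in_itv/= => /andP[ts st]; have s0 : 0 < s by exact: lt_trans ts.
rewrite mem_set/= ?in_itv/= ?s0// lee_fin mulrC; apply: ler_pM; rewrite ?powR_ge0//.
  by rewrite ge0_ler_powR ?nnegrE ?subr_ge0 ?(ltW th1) ?m_ni ?(ltW st).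
rewrite -[leLHS]mul1r; apply: ler_pM; rewrite ?powR_ge0//.
by rewrite ge0_ler_powR ?nnegrE ?subr_ge0 ?(ltW t20) ?(ltW s0) ?(ltW ts).
Qed.

(** Chosen so that 2^p dl^(1-th) = 1/2: exactly half of [A] is to be absorbed. *)
Let dl := (2 `^ (- (p + 1))) `^ (1 - th)^-1.
Let dl0 : 0 < dl. Proof. by rewrite !powR_gt0. Qed.
Let dlE : 2 `^ p * dl `^ (1 - th) = 2^-1.
Proof.
rewrite /dl -powRrM mulVf ?powRr1 ?powR_ge0 ?gt_eqF ?subr_gt0//.
rewrite -powRD; last by rewrite pnatr_eq0 implybT.
by rewrite opprD addNKr powR_inv1.
Qed.

Lemma weight_integral_doubling : (A < +oo)%E ->
  (A <= (2 * (2 `^ p * dl `^ (- th)))%:E *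
    \int[leb]_(t in `]0%R, +oo[) (m (2 * t) * m t `^ (- th) * w t)%:E)%E.
Proof.
pose c := 2 `^ p * dl `^ (- th); pose j t := m (2 * t) * m t `^ (- th) * w t.
pose J := (\int[leb]_(t in `]0%R, +oo[) (j t)%:E)%E.
move=> Aoo; suff AJ : (A <= (2 * c)%:E * J)%E by exact: AJ.
have c0 : 0 < c by rewrite mulr_gt0 ?powR_gt0.
have j0 t : 0 <= j t by rewrite !mulr_ge0 ?powR_ge0 ?m0 ?(ltW p0).
have mj : measurable_fun setT j.
  do 2 apply: measurable_funM => //.
    by apply: (measurableT_comp mm); exact: measurable_funM.
  exact: (measurableT_comp (@measurable_powR R _)).
have A0 : (0 <= A)%E by apply: integral_ge0 => t _; rewrite lee_fin a0.
(* Substitution of 2 t for t; with the density it produces the factor 2 (2 t)^(p-1) = 2^p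
   t^(p-1). *)
have Adbl : (A = \int[leb]_(t in `]0%R, +oo[) (2 * a (2 * t))%:E)%E.
  pose G t := (if (0 < t)%R then (a t)%:E else 0)%E.
  have G0 t : (0 <= G t)%E by rewrite /G; case: ifP => // _; rewrite lee_fin a0.
  have mG : measurable_fun setT G.
    apply: measurable_fun_ifT => //; first exact: measurable_fun_ltr.
    exact/measurable_EFinP.
  have := ge0_integral_affine 0 (ltr0Sn _ 1) mG G0 => /(congr1 (mule 2%:E)).
  rewrite muleA -EFinM divff// mul1e ge0_integral_ioy -/a => <-.
  rewrite -ge0_integralZl//; last first.
    by apply: (measurableT_comp mG); apply: measurable_funD => //; exact: measurable_funM.
  rewrite ge0_integral_ioy; apply: eq_integral => t _.
  by rewrite addr0 /G pmulr_rgt0//; case: ifP; rewrite ?mule0.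
(* The split is applied with u = m(2 t) and v = m(t), and [dlE] turns its second coefficient into
   1/2. *)
have Aj : (A <= c%:E * J + 2^-1%:E * A)%E.
  have pos (c' : R) (g : R -> R) (D : set R) : 0 <= c' -> (forall t, 0 <= g t) ->
      forall t, D t -> (0 <= c'%:E * (g t)%:E)%E.
    by move=> c'0 g0 t _; rewrite -EFinM lee_fin mulr_ge0.
  have mZ (c' : R) (g : R -> R) (D : set R) : measurable_fun setT g ->
      measurable_fun D (fun t => (c'%:E * (g t)%:E)%E).
    by move=> mg; apply/measurable_EFinP/measurable_funTS; exact: measurable_funM.
  rewrite {1}Adbl -!ge0_integralZl//=.
  - rewrite -ge0_integralD//=; [|by apply: pos; rewrite ?(ltW c0)|exact: mZ
      |by apply: (pos _ a); rewrite ?invr_ge0|exact: (mZ _ a)].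
    apply: ge0_le_integral_nonmeas => t /=; rewrite in_itv/= andbT => t0.
      by rewrite lee_fin mulr_ge0.
    rewrite -!EFinM -EFinD lee_fin.
    have -> : 2 * a (2 * t) = 2 `^ p * m (2 * t) `^ (1 - th) * w t.
      rewrite /a /w powRM ?(ltW t0)// -[in RHS](@mulr_powRB1 _ 2 p)//.
      by ring.
    have mt2 : m (2 * t) <= m t by apply: m_ni => //; rewrite ler_peMl ?(ltW t0)// ler1n.
    have := powR_onem_split (th := th) (dl := dl) _ dl0 (m0 (2 * t)) mt2.
    rewrite th0 th1 => /(_ isT) /(ler_wpM2l (powR_ge0 2 p)) /(ler_wpM2r (w0 t)).
    by move/le_trans; apply; rewrite -dlE /c /j /a le_eqVlt; apply/orP; left; apply/eqP; ring.
  - exact/measurable_EFinP/measurable_funTS.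
  - by move=> t _; rewrite lee_fin a0.
  - exact/measurable_EFinP/measurable_funTS.
  - by move=> t _; rewrite lee_fin j0.
  - by rewrite lee_fin ltW.
(* An infinite [J] makes the bound trivial. Otherwise [A] and [J] are both real, and A/2 can be
   subtracted. *)
have [Jf|] := ltP J +oo%E; last first.
  by rewrite leye_eq => /eqP ->; rewrite gt0_muley ?leey// lte_fin mulr_gt0.
have J0 : (0 <= J)%E by apply: integral_ge0 => t _; rewrite lee_fin j0.
move: Aj; rewrite -(fineK (_ : A \is a fin_num)) ?ge0_fin_numE//.
rewrite -(fineK (_ : J \is a fin_num)) ?ge0_fin_numE//.
by rewrite -!EFinM -EFinD !lee_fin; lra.
Qed.

End DistributionFunction.

Section DistributionPower.
Context (R : realType).
Local Notation leb := (@lebesgue_measure R).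

(** One factor (t^p m(t)^(1-th))^(th/(1-th)) is split off the integrand and bounded through the
    weak-type hypothesis; what remains is the integrand of (1), up to the factor p >= 1. *)
Lemma weak_type_integral_le (p th A : R) (m : R -> R) : 1 <= p -> 0 < th -> th < 1 ->
  (forall t, 0 <= m t) -> 0 <= A ->
  (forall t, 0 < t -> t `^ p * m t `^ (1 - th) <= A) ->
  (\int[leb]_(t in `]0%R, +oo[) (t `^ (p / (1 - th) - 1) * m t)%:E <=
   \int[leb]_(t in `]0%R, +oo[)
     (A `^ (th / (1 - th)) * (m t `^ (1 - th) * (p * t `^ (p - 1))))%:E)%E.
Proof.
move=> p1 th0 th1 m0 A0 mA; apply: ge0_le_integral_nonmeas => t /=.
  by rewrite lee_fin mulr_ge0 ?powR_ge0.
rewrite in_itv/= andbT => t0; rewrite lee_fin.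
have th1' : 1 - th != 0 by rewrite gt_eqF ?subr_gt0.
have tn0 : t != 0 by rewrite gt_eqF.
(* Exponents: th + (1 - th) = 1 for m(t), and p th/(1-th) + p - 1 = p/(1-th) - 1 for t. *)
have -> : t `^ (p / (1 - th) - 1) * m t =
    (t `^ p * m t `^ (1 - th)) `^ (th / (1 - th)) * (m t `^ (1 - th) * t `^ (p - 1)).
  rewrite powRM ?powR_ge0// -!powRrM [m t `^ (1 - th) * t `^ _]mulrC mulrACA.
  have e1 : (1 - th) * (th / (1 - th)) + (1 - th) = 1 by field.
  rewrite -!powRD ?tn0 ?implybT// ?e1 ?oner_eq0//.
  by rewrite powRr1//; congr (_ `^ _ * _); field.
apply: ler_pM; rewrite ?mulr_ge0 ?powR_ge0//.
  by apply: ge0_ler_powR;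
    rewrite ?nnegrE ?mulr_ge0 ?powR_ge0 ?invr_ge0 ?(ltW th0) ?subr_ge0 ?(ltW th1) ?mA.
by apply: ler_wpM2l; rewrite ?powR_ge0// ler_peMl ?powR_ge0.
Qed.

End DistributionPower.

(** * Lower bound on the Besov energy *)

Section Kernel.
Context (R : realType) (n : nat).
Local Notation mu := (rowmeasure R n).

Lemma measurable_box (a b : R) : measurable [set x : 'rV[R]_n | forall i, a < x 0 i <= b].
Proof.
have -> : [set x : 'rV[R]_n | forall i, a < x 0 i <= b] =
    \bigcap_(i in [set: 'I_n]) (fun x : 'rV[R]_n => x 0 i) @^-1` `]a, b]%classic.
  by apply/seteqP; split=> x /= h i; [move=> _|]; have := h i; rewrite /= in_itv//; apply.
apply: fin_bigcap_measurable => // i _; rewrite -[X in measurable X]setTI.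
exact: measurable_coord.
Qed.

Lemma rowmeasure_box (a b : R) : a <= b ->
  mu [set x : 'rV[R]_n | forall i, a < x 0 i <= b] = ((b - a) ^+ n)%:E.
Proof. by move=> ab; rewrite -volE ?vol_box//; exact: measurable_box. Qed.

Lemma enorm_ge0 (x : 'rV[R]_n) : 0 <= enorm x.
Proof. exact: sqrtr_ge0. Qed.

Lemma enorm_ge_coord (x : 'rV[R]_n) i : `|x 0 i| <= enorm x.
Proof.
rewrite -sqrtr_sqr; apply: ler_wsqrtr; rewrite (bigD1 i)//= lerDl.
by apply: sumr_ge0 => j _; rewrite sqr_ge0.
Qed.

Lemma enorm_le_coord (x : 'rV[R]_n) (r : R) : 0 <= r -> (forall i, `|x 0 i| <= r) ->
  enorm x <= n%:R * r.
Proof.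
move=> r0 xr; rewrite -[leRHS]ger0_norm ?mulr_ge0// -sqrtr_sqr.
apply: ler_wsqrtr; apply: (@le_trans _ _ (\sum_(i < n) r ^+ 2)).
  by apply: ler_sum => i _; rewrite -real_normK ?num_real// lerXn2r ?nnegrE.
rewrite sumr_const card_ord exprMn -[leLHS]mulr_natl; apply: ler_wpM2r; rewrite ?sqr_ge0//.
by rewrite -natrX ler_nat; case: (n) => // k; rewrite leq_pmulr.
Qed.

Lemma measurable_translate (E : set 'rV[R]_n) (x : 'rV[R]_n) : measurable E ->
  measurable [set h | E (x + h)].
Proof.
move=> mE; rewrite -[X in measurable X]setTI.
suff mT : measurable_fun setT (fun h : 'rV[R]_n => x + h) by exact: mT.
apply/measurable_rowP => i; under eq_fun do rewrite mxE.
by apply: measurable_funD => //; exact: measurable_coord.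
Qed.

Lemma rowmeasure_shift (E : set 'rV[R]_n) (x : 'rV[R]_n) : measurable E ->
  mu [set h | E (x + h)] = mu E.
Proof.
move=> mE; have mF := measurable_translate x mE.
rewrite -!volE// /vol -(@iint_shift _ _ (fun y => (\1_E y)%:E) x).
- congr iint; apply/funext => h; rewrite !indicE; congr (nat_of_bool _)%:R%:E.
  by apply/asboolP/asboolP => /=; rewrite addrC.
- by apply/measurable_EFinP; exact: measurable_indic.
- by move=> h; rewrite lee_fin.
Qed.

(* At least half of the box ]0, r]^n with r^n = 2 |E| lies outside E - x.  The
   box avoids the origin, where the kernel takes the junk value 0. *)
Lemma kernel_tail_ge (s : R) : (0 < n)%N -> 0 < s -> exists2 c : R, 0 < c &
  forall (E : set 'rV[R]_n) x, measurable E -> (0 < mu E < +oo)%E ->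
  ((c * fine (mu E) `^ (- (s / n%:R)))%:E <=
    \int[mu]_(h in [set h | ~ E (x + h)%R]) (enorm h `^ (- (n%:R + s)))%:E)%E.
Proof.
move=> n0 s0; have nR0 : 0 < n%:R :> R by rewrite ltr0n.
pose e := n%:R + s; have e0 : 0 < e by rewrite addr_gt0.
exists (n%:R `^ (- e) * 2 `^ (- (e / n%:R))); first by rewrite mulr_gt0 ?powR_gt0.
move=> E x mE /andP[E0 Eoo].
have Efin : mu E \is a fin_num by rewrite ge0_fin_numE ?ltW.
set v := fine (mu E); have v0 : 0 < v by rewrite fine_gt0 ?E0.
pose r := (2 * v) `^ n%:R^-1.
have r0 : 0 < r by rewrite powR_gt0 ?mulr_gt0.
have rn : r ^+ n = 2 * v.
  by rewrite -powR_mulrn ?(ltW r0)// /r -powRrM mulVf ?gt_eqF// powRr1// mulr_ge0 ?(ltW v0).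
pose Q : set 'rV[R]_n := [set h | forall i, 0 < h 0 i <= r].
pose F := [set h | E (x + h)].
have mQ : measurable Q by exact: measurable_box.
have mF : measurable F by exact: measurable_translate.
have vA : (v%:E <= mu (Q `\` F))%E.
  have : (mu Q <= mu (Q `\` F) + mu F)%E.
    apply: le_trans (measureU2 _ _ _) => //; last exact: measurableD.
    apply: le_measure; rewrite ?inE//; first by apply: measurableU => //; exact: measurableD.
    by move=> h Qh; have [Fh|Fh] := pselect (F h); [right|left].
  rewrite rowmeasure_box ?(ltW r0)// subr0 rn rowmeasure_shift// -(fineK Efin) -/v.
  by rewrite -leeBlDr// -EFinB; congr (_%:E <= _)%E; ring.
(* On the box |h| <= n r, so the kernel is at least [k] there. The powers of v combine through 1 -
   (n + s)/n = -s/n. *)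
pose k := (n%:R * r) `^ (- e).
have kE : n%:R `^ (- e) * 2 `^ (- (e / n%:R)) * v `^ (- (s / n%:R)) = k * v.
  rewrite /k powRM ?(ltW r0) ?(ltW nR0)// -!mulrA; congr (_ * _).
  rewrite /r -powRrM mulrN [n%:R^-1 * e]mulrC powRM ?(ltW v0)// -mulrA; congr (_ * _).
  rewrite -[X in _ = _ * X](powRr1 (ltW v0)) -powRD ?(gt_eqF v0) ?implybT//.
  by congr (_ `^ _); rewrite /e; field; rewrite gt_eqF.
rewrite kE EFinM.
apply: (@le_trans _ _ (k%:E * mu (Q `\` F))%E).
  by apply: lee_wpmul2l => //; rewrite lee_fin powR_ge0.
rewrite -integral_cst; last exact: measurableD.
rewrite integral_mkcond [leRHS]integral_mkcond.
apply: ge0_le_integral_nonmeas => h _; rewrite !patchE.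
  by case: ifPn => // _; rewrite lee_fin powR_ge0.
case: ifPn => [|_]; last by case: ifPn => // _; rewrite lee_fin powR_ge0.
rewrite inE => -[Qh Fh]; rewrite mem_set// lee_fin.
apply: ler_powRN (ltW e0) => //.
  have := Qh (Ordinal n0) => /andP[h0 _]; apply: lt_le_trans (enorm_ge_coord h (Ordinal n0)).
  by rewrite normr_gt0 gt_eqF.
apply: enorm_le_coord (ltW r0) _ => i; have /andP[h0 hr] := Qh i.
by rewrite gtr0_norm.
Qed.

End Kernel.

Section Energy.
Context (R : realType) (n : nat).
Local Notation mu := (rowmeasure R n).
Local Notation leb := (@lebesgue_measure R).

Lemma measurable_levelset (f : 'rV[R]_n -> R) t : measurable_fun setT f ->
  measurable (levelset f t).
Proof. by move=> mf; apply: measurable_lt_set => //; exact: measurableT_comp. Qed.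

(** Real-valued, to fit the one-dimensional lemmas. Since [fine] sends +oo to 0, it is the true
    measure only where the level set has finite measure. *)
Definition distr (f : 'rV[R]_n -> R) (t : R) : R := fine (mu (levelset f t)).

Lemma distr_ge0 (f : 'rV[R]_n -> R) t : 0 <= distr f t.
Proof. exact: fine_ge0. Qed.

(** The measure of the level set is a partial integral of the indicator of {(t, x) : t < |f x|}, so
    Tonelli's theorem gives measurability in t. *)
Lemma measurable_distr (f : 'rV[R]_n -> R) : measurable_fun setT f ->
  measurable_fun setT (distr f).
Proof.
move=> mf.
pose F (z : measurableTypeR R * 'rV[R]_n) : \bar R := (if z.1 < `|f z.2| then 1 else 0)%:E.
have mF : measurable_fun setT F.
  apply/measurable_EFinP; apply: measurable_fun_ifT => //.
  by apply: measurable_fun_ltr => //; do 2 apply: measurableT_comp => //.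
have F0 z : (0 <= F z)%E by rewrite lee_fin; case: ifP.
suff mF' : measurable_fun setT (fun t => mu (levelset f t)).
  exact: (measurableT_comp (fine_measurable measurableT) mF').
rewrite (_ : (fun t => _) = fubini_F mu F); first exact: measurable_fun_fubini_tonelli_F.
apply/funext => t; rewrite /fubini_F -(setIT (levelset f t)) -integral_indic//;
  last exact: measurable_levelset.
apply: eq_integral => x _; rewrite /F/= indicE; congr (_%:E).
by case: ifPn => [tf|/negP tf]; [rewrite mem_set|rewrite memNset].
Qed.

Lemma measurable_fun_addrow (f : 'rV[R]_n -> R) d (T : measurableType d)
    (x h : T -> 'rV[R]_n) : measurable_fun setT f ->
  measurable_fun setT x -> measurable_fun setT h ->
  measurable_fun setT (fun t => f (x t + h t)).
Proof.
move=> mf mx mh; apply: (measurableT_comp mf).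
by apply: (measurableT_comp (@measurable_addrow R n) (g := fun t => (x t, h t)));
  exact: measurable_fun_pair.
Qed.

(** The same triple integral is taken in two orders. With the increment h innermost, the kernel tail
    bound gives the left side; with the level t innermost, the result is at most |f(x+h) - f(x)|^p /
    p times the kernel, up to the factor p placed in the constant. *)
Lemma energy_ge (p s : R) : (0 < n)%N -> 1 <= p -> 0 < s -> exists2 c : R, 0 < c &
  forall f : 'rV[R]_n -> R, measurable_fun setT f ->
    (forall t, 0 < t -> (mu (levelset f t) < +oo)%E) ->
    (c%:E * \int[leb]_(t in `]0%R, +oo[)
        (distr f (2 * t) * distr f t `^ (- (s / n%:R)) * (p * t `^ (p - 1)))%:E <=
     \int[mu]_h \int[mu]_x (`|f (x + h)%R - f x| `^ p * enorm h `^ (- (n%:R + s)))%:E)%E.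
Proof.
move=> n0 p1 s0; have [c c0 tail] := @kernel_tail_ge R n s n0 s0.
have p0 : 0 < p by lra.
exists (c / p) => [|f mf ffin]; first by rewrite divr_gt0.
pose m := distr f; rewrite -/m.
pose K (h : 'rV[R]_n) := enorm h `^ (- (n%:R + s)).
have K0 h : 0 <= K h by exact: powR_ge0.
have mK : measurable_fun setT K.
  by apply: (measurableT_comp (@measurable_powR R _)); exact: measurable_enorm.
have mm : measurable_fun setT m by exact: measurable_distr.
have m0 t : 0 <= m t by exact: distr_ge0.
have mE t : 0 < t -> (m t)%:E = mu (levelset f t).
  by move=> t0; rewrite /m /distr fineK// ge0_fin_numE// ffin.
(* The condition says that x lies in {|f| > 2t} while x + h lies outside {|f| > t}. *)
pose G (t : measurableTypeR R) (x h : 'rV[R]_n) : \bar R :=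
  (if (0 < t < `|f x| / 2) && (`|f (x + h)| <= t) then t `^ (p - 1) * K h else 0)%:E.
have G0 t x h : (0 <= G t x h)%E.
  by rewrite lee_fin; case: ifP => // _; rewrite mulr_ge0 ?powR_ge0.
have mG : measurable_fun setT
    (fun z : measurableTypeR R * 'rV[R]_n * 'rV[R]_n => G z.1.1 z.1.2 z.2).
  have m1 : measurable_fun setT (fun z : measurableTypeR R * 'rV[R]_n * 'rV[R]_n => z.1.1).
    exact: measurableT_comp.
  have m2 : measurable_fun setT (fun z : measurableTypeR R * 'rV[R]_n * 'rV[R]_n => z.1.2).
    exact: measurableT_comp.
  apply/measurable_EFinP; apply: measurable_fun_ifT => //.
    apply: measurable_and; first apply: measurable_and; [exact: measurable_fun_ltr| |].
      apply: measurable_fun_ltr => //; apply: measurable_funM => //.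
      by apply: (measurableT_comp (@normr_measurable R setT)); exact: measurableT_comp.
    apply: measurable_fun_ler => //; apply: (measurableT_comp (@normr_measurable R setT)).
    exact: measurable_fun_addrow.
  apply: measurable_funM; last exact: measurableT_comp.
  exact: (measurableT_comp (@measurable_powR R _)).
apply: (@le_trans _ _ (\int[leb]_t \int[mu]_x \int[mu]_h G t x h)%E).
  rewrite -ge0_integralZl//=; last 3 first.
  - apply/measurable_EFinP/measurable_funTS; do 2 apply: measurable_funM => //.
    + by apply: (measurableT_comp mm); exact: measurable_funM.
    + exact: (measurableT_comp (@measurable_powR R _)).
  - by move=> t _; rewrite lee_fin !mulr_ge0 ?powR_ge0 ?m0 ?(ltW p0).
  - by rewrite lee_fin divr_ge0 ?ltW.
  rewrite ge0_integral_ioy; apply: ge0_le_integral_nonmeas => t _.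
    by case: ifP => // _; rewrite -EFinM lee_fin !mulr_ge0
      ?powR_ge0 ?invr_ge0 ?m0 ?(ltW p0) ?(ltW c0).
  case: ifPn => t0; last by do 2 (apply: integral_ge0 => ? _).
  have t20 : 0 < 2 * t by rewrite mulr_gt0.
  have m2t : m (2 * t) <= m t.
    rewrite -lee_fin !mE//; apply: le_measure; rewrite ?inE; [exact: measurable_levelset..|].
    by move=> x /=; apply: lt_trans; rewrite ltr_pMl// ltr1n.
  (* The tail bound requires positive measure; if {|f| > t} is null, then so is {|f| > 2t}. *)
  have [mt0|mt0] := eqVneq (m t) 0.
    rewrite (_ : m (2 * t) = 0) ?mul0r ?mule0; last by apply/eqP; rewrite eq_le m0 -mt0 m2t.
    by do 2 (apply: integral_ge0 => ? _).
  have Et0 : (0 < mu (levelset f t) < +oo)%E by rewrite ffin// -mE// lte_fin lt_def mt0 m0.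
  rewrite -EFinM (_ : c / p * _ = c * m t `^ (- (s / n%:R)) * t `^ (p - 1) * m (2 * t)); last first.
    by field; rewrite gt_eqF.
  rewrite EFinM mE// -integral_cst; last exact: measurable_levelset.
  rewrite integral_mkcond; apply: ge0_le_integral_nonmeas => x _; rewrite patchE.
    by case: ifP => // _; rewrite lee_fin !mulr_ge0 ?powR_ge0 ?(ltW c0).
  case: ifPn => [|_]; last by apply: integral_ge0.
  rewrite inE /levelset/= => tx.
  have mD : measurable [set h | ~ levelset f t (x + h)].
    by apply: measurableC; apply: measurable_translate; exact: measurable_levelset.
  have tailx := tail _ x (measurable_levelset t mf) Et0.
  apply: (@le_trans _ _ ((t `^ (p - 1))%:E *
      \int[mu]_(h in [set h | ~ levelset f t (x + h)%R]) (K h)%:E)%E).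
    by rewrite mulrC EFinM; apply: lee_wpmul2l => //; rewrite lee_fin powR_ge0.
  rewrite -ge0_integralZl//=; [|by apply/measurable_EFinP/measurable_funTS
    |by move=> h _; rewrite lee_fin|by rewrite lee_fin powR_ge0].
  rewrite integral_mkcond; apply: ge0_le_integral_nonmeas => h _; rewrite patchE.
    by case: ifP => // _; rewrite -EFinM lee_fin mulr_ge0 ?powR_ge0.
  case: ifPn => // /[!inE] /= /negP; rewrite -leNgt => fh.
  by rewrite /G fh ltr_pdivlMr// [t * 2]mulrC tx t0.
rewrite tonelli_rev3//.
apply: ge0_le_integral_nonmeas => h _; first by do 2 (apply: integral_ge0 => ? _).
apply: ge0_le_integral_nonmeas => x _; first by apply: integral_ge0.
set D := `|f x| - `|f (x + h)|.
have GD t : (G t x h <= (if 0 < t < D then t `^ (p - 1) else 0)%:E * (K h)%:E)%E.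
  rewrite /G -EFinM lee_fin; case: ifPn => [/andP[/andP[t0 tx] ht]|_].
    by rewrite t0 (_ : t < D)//; rewrite /D; move: tx; rewrite ltr_pdivlMr//; lra.
  by rewrite mulr_ge0//; case: ifP => // _; rewrite powR_ge0.
(* For [G t x h != 0] one has [t < |f x| - t <= |f x| - |f (x + h)| = D]. *)
have [D0|D0] := leP D 0.
  rewrite integral0_eq ?lee_fin ?mulr_ge0 ?powR_ge0// => t _.
  apply/eqP; rewrite eq_le G0 andbT; apply: le_trans (GD t) _.
  by case: ifPn => [/andP[t0 /lt_le_trans/(_ D0)/lt_trans/(_ t0)]|_]; rewrite ?ltxx// mul0e.
apply: (@le_trans _ _ (\int[leb]_t ((if 0 < t < D then t `^ (p - 1) else 0)%:E * (K h)%:E))%E).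
  exact: ge0_le_integral_nonmeas.
rewrite ge0_integralZr ?lee_fin//; last 2 first.
- apply/measurable_EFinP; apply: measurable_fun_ifT => //.
  by apply: measurable_and; exact: measurable_fun_ltr.
- by move=> t _; rewrite lee_fin; case: ifP => // _; rewrite powR_ge0.
rewrite EFinM; apply: lee_wpmul2r; first by rewrite lee_fin.
(* The integral in t is at most D^p, and D <= |f(x+h) - f(x)| by the reverse triangle inequality. *)
apply: (le_trans (integral_powR_le D0 p1)).
rewrite lee_fin ge0_ler_powR ?nnegrE ?(ltW p0) ?(ltW D0)//.
by rewrite distrC; exact: lerB_dist.
Qed.

End Energy.

(** * The bathtub inequality for a power weight *)

Section Bathtub.
Context (R : realType).
Local Notation leb := (@lebesgue_measure R).

Lemma powRN_cvgy (b : R) : 0 < b -> x `^ (- b) @[x --> +oo%R] --> (0 : R).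
Proof.
move=> b0; apply/cvgrPdist_lt => e e0; near=> x.
(* The threshold solves x^(-b) = e. *)
have xe : e `^ (- b^-1) < x by near: x; exact: nbhs_pinfty_gt.
have ye : 0 < e `^ (- b^-1) by rewrite powR_gt0.
have x0 : 0 < x by exact: lt_trans xe.
rewrite sub0r normrN ger0_norm ?powR_ge0//.
have -> : e = (e `^ (- b^-1)) `^ (- b).
  by rewrite -powRrM mulrNN mulVf ?gt_eqF// powRr1 ?ltW.
rewrite 2![_ `^ (- b)]powRN ltf_pV2 ?posrE ?powR_gt0//.
by rewrite gt0_ltr_powR ?nnegrE ?(ltW x0) ?(ltW ye).
Unshelve. all: by end_near. Qed.

Lemma integral_powRN_tail (b s0 : R) : 1 < b -> 0 < s0 ->
  (\int[leb]_(t in `[s0, +oo[) (t `^ (- b))%:E = (s0 `^ (1 - b) / (b - 1))%:E)%E.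
Proof.
move=> b1 s00; have b10 : 0 < b - 1 by rewrite subr_gt0.
pose F x : R := - (b - 1)^-1 * x `^ (1 - b).
have dF (x : R) : 0 < x -> is_derive x 1 F (x `^ (- b)).
  move=> x0; have H := is_derive1_powR (1 - b) x0.
  apply: (is_derive_eq (is_deriveZ (- (b - 1)^-1) H)).
  rewrite /GRing.scale/= mulrA (_ : - _ * _ = 1); last by field; rewrite gt_eqF.
  by rewrite mul1r; congr (_ `^ _); ring.
have cpow (c x : R) : 0 < x -> {for x, continuous (fun y : R => y `^ c)}.
  move=> x0; apply: differentiable_continuous; apply/derivable1_diffP.
  by have [] := is_derive1_powR c x0.
rewrite (@ge0_continuous_FTC2y _ _ F _ 0).
- rewrite sub0e /F -EFinN; congr (_%:E); field.
  by rewrite gt_eqF.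
- by move=> x _; exact: powR_ge0.
- apply: continuous_in_subspaceT => x /[!inE]/=; rewrite in_itv/= andbT => sx.
  by apply: cpow; exact: lt_le_trans sx.
- rewrite /F -(mulr0 (- (b - 1)^-1)); apply: cvgMr.
  by rewrite -opprB; exact: powRN_cvgy.
- by move=> x sx; have [] := dF x (lt_trans s00 sx).
- apply: cvg_at_right_filter; rewrite /F; apply: cvgMr; exact: cpow.
- move=> x; rewrite in_itv/= andbT => sx.
  by rewrite derive1E; have [_ ->] := dF x (lt_trans s00 sx).
Qed.

(** By the layer cake formula it suffices to integrate over s the measure of E within {|x|^-al > s}.
    This is at most |E| and at most 2^n s^(-n/al); the first bound is used for small s, the second
    for large s. *)
Lemma riesz_bathtub (n : nat) (al : R) : (0 < n)%N -> 0 < al -> al < n%:R ->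
  exists2 C : R, 0 < C & forall E : set 'rV[R]_n, measurable E ->
    (rowmeasure R n E < +oo)%E ->
    (\int[rowmeasure R n]_(x in E) ((enorm x `^ al)^-1)%:E <=
     (C * fine (rowmeasure R n E) `^ (1 - al / n%:R))%:E)%E.
Proof.
move=> n0 al0 aln; have nR0 : 0 < n%:R :> R by rewrite ltr0n.
set mu := rowmeasure R n; pose th := al / n%:R.
have th0 : 0 < th by rewrite divr_gt0.
have th1 : th < 1 by rewrite ltr_pdivrMr// mul1r.
have b1 : 1 < th^-1 by rewrite invf_gt1.
have bb : 0 < th^-1 - 1 by rewrite subr_gt0.
(* The factor 2 comes from the layer cake formula, the 1 from the levels below [s0], and the
   fraction from the tail above [s0]. *)
exists (2 * (1 + 2 ^+ n / (th^-1 - 1))) => [|E mE Eoo].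
  by rewrite mulr_gt0// addr_gt0// divr_gt0// exprn_gt0.
(* At the origin this takes the default value 0 instead of infinity, which affects only a null
   set. *)
pose W (x : 'rV[R]_n) := (enorm x `^ al)^-1.
have W0 x : 0 <= W x by rewrite invr_ge0 powR_ge0.
have WE x : W x = enorm x `^ (- al) by rewrite powRN.
have mW : measurable_fun setT W.
  rewrite (_ : W = fun x => enorm x `^ (- al)); last exact/funext.
  by apply: (measurableT_comp (@measurable_powR R _)); exact: measurable_enorm.
have mS s : measurable [set x | s < `|W x|].
  by apply: measurable_lt_set => //; exact: measurableT_comp.
have Efin : mu E \is a fin_num by rewrite ge0_fin_numE.
have mES s : measurable (E `&` [set x | s < `|W x|]) by exact: measurableI.
have cake : (\int[mu]_(x in E) (W x)%:E <= 2%:E *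
    \int[leb]_(s in `]0%R, +oo[) mu (E `&` [set x | s < `|W x|]%R))%E.
  have indE0 x : 0 <= \1_E x :> R by rewrite indicE.
  have := layer_cake mu mW (measurable_indic (D := setT) mE) indE0 (lexx 1).
  rewrite powRr1// => cake.
  rewrite integral_mkcond (le_trans _ (le_trans cake _))//.
    apply: ge0_le_integral_nonmeas => x _; rewrite patchE.
      by case: ifP => // _; rewrite lee_fin.
    rewrite powRr1// ger0_norm// indicE; case: ifPn => _; first by rewrite mulr1.
    by rewrite mulr0.
  apply: lee_wpmul2l => //; apply: ge0_le_integral_nonmeas => s _.
    by apply: mule_ge0; [rewrite lee_fin powR_ge0|apply: integral_ge0 => x _; rewrite lee_fin].
  by rewrite subrr powRr0 mul1e integral_indic.
(* The superlevel set of the weight is the ball of radius r = s^(-1/al), contained in a cube of side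
   2 r. *)
have muS s : 0 < s -> (mu (E `&` [set x | (s < `|W x|)%R]) <= (2 ^+ n * s `^ (- th^-1))%:E)%E.
  move=> s0; pose r := s `^ (- al^-1).
  have r0 : 0 < r by rewrite powR_gt0.
  have -> : 2 ^+ n * s `^ (- th^-1) = (r - (- r)) ^+ n.
    rewrite (_ : r - - r = 2 * r) ?exprMn; last by ring.
    congr (_ * _).
    rewrite -powR_mulrn ?(ltW r0)// /r -powRrM; congr (_ `^ _).
    by rewrite /th invf_div mulNr mulrC.
  rewrite -rowmeasure_box; last by rewrite (@le_trans _ _ 0) ?oppr_le0 ?(ltW r0).
  apply: le_measure; rewrite ?inE//; first exact: measurable_box.
  move=> x [_] /=; rewrite ger0_norm// WE => sx i.
  have xr : enorm x < r.
    rewrite ltNge; apply/negP => rx; move: sx; apply/negP; rewrite -leNgt.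
    have -> : s = r `^ (- al).
      by rewrite /r -powRrM mulrNN mulVf ?gt_eqF// powRr1 ?(ltW s0).
    exact: ler_powRN (ltW al0).
  have := le_lt_trans (enorm_ge_coord x i) xr; rewrite ltr_norml => /andP[-> /ltW].
  by [].
have [E0|E0] := eqVneq (mu E) 0%E.
  apply: (le_trans cake); rewrite E0 powR0; last by rewrite gt_eqF ?subr_gt0.
  rewrite mulr0 (_ : (\int[leb]_(s in _) _ = 0)%E) ?mule0//.
  apply: integral0_eq => s _; apply/eqP; rewrite eq_le measure_ge0 andbT -E0.
  by apply: le_measure; rewrite ?inE// => x [].
set v := fine (mu E); have v0 : 0 < v by rewrite fine_gt0// lt0e E0 measure_ge0.
(* The level at which s^(-1/th) equals v, so that both parts of the integral scale like v^(1-th). *)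
pose s0 := v `^ (- th); have s00 : 0 < s0 by rewrite powR_gt0.
apply: (le_trans cake); rewrite -mulrA EFinM; apply: lee_wpmul2l => //.
apply: (@le_trans _ _ (\int[leb]_(s in `]0%R, s0[) v%:E +
    \int[leb]_(s in `[s0, +oo[) ((2 ^+ n)%:E * (s `^ (- th^-1))%:E))%E).
  have mpow : measurable_fun setT (fun s : R => ((2 ^+ n)%:E * (s `^ (- th^-1))%:E)%E).
    apply/measurable_EFinP; apply: measurable_funM => //.
  rewrite [leLHS]integral_mkcond [X in (_ <= X + _)%E]integral_mkcond.
  rewrite [X in (_ <= _ + X)%E]integral_mkcond.
  have mc : measurable_fun setT ((fun=> v%:E) \_ `]0%R, s0[ : R -> \bar R).
    exact/(measurable_restrictT _ _).1.
  have mp : measurable_fun setT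
      ((fun s : R => ((2 ^+ n)%:E * (s `^ (- th^-1))%:E)%E) \_ `[s0, +oo[).
    by apply/(measurable_restrictT _ _).1 => //; exact: measurable_funTS.
  rewrite -ge0_integralD => //; [|move=> s _..]; first last.
  - apply: erestrict_ge0 => x _.
    by rewrite -EFinM lee_fin mulr_ge0 ?powR_ge0 ?exprn_ge0.
  - by apply: erestrict_ge0 => x _; rewrite lee_fin ltW.
  apply: ge0_le_integral_nonmeas => s _; rewrite !patchE.
    by case: ifP.
  rewrite !mem_setE !in_itv/= andbT; case: ifPn => [sp|_].
    case: ltP => s0s; rewrite ?add0e ?adde0.
      by rewrite /v fineK//; apply: le_measure; rewrite ?inE// => x [].
    by rewrite -EFinM muS.
  rewrite andFb add0e; case: ifP => // _.
  by rewrite -EFinM lee_fin mulr_ge0 ?powR_ge0 ?exprn_ge0.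
rewrite integral_cst//= lebesgue_measure_itv/= lte_fin s00 oppr0 adde0.
rewrite ge0_integralZl//=; [|by apply/measurable_EFinP/measurable_funTS
  |by move=> s _; rewrite lee_fin powR_ge0].
rewrite integral_powRN_tail// -!EFinM -EFinD lee_fin.
have e1 : v * s0 = v `^ (1 - th).
  by rewrite powRD ?(gt_eqF v0) ?implybT// powRr1 ?(ltW v0).
have e2 : s0 `^ (1 - th^-1) = v `^ (1 - th).
  by rewrite /s0 -powRrM; congr (_ `^ _); field; rewrite gt_eqF.
rewrite e1 e2 -/th; move: (th^-1 - 1) (v `^ (1 - th)) bb => X Y X0.
by rewrite mulrDl mul1r [Y / X]mulrC mulrA.
Qed.

End Bathtub.

(** * Test functions and the Besov energy *)

Section TestFunctions.
Context (R : realType) (n : nat).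
Local Notation mu := (rowmeasure R n).

Lemma coord_le_mx_norm (x : 'rV[R]_n) i : `|x 0 i| <= `|x|.
Proof.
rewrite [leRHS]mx_normrE.
exact: (le_bigmax_cond _ (fun ij : 'I_1 * 'I_n => `|x ij.1 ij.2|) (j := (0, i))).
Qed.

Lemma compact_coord_bounded (K : set 'rV[R]_n) : compact K ->
  exists2 r : R, 0 < r & forall x, K x -> forall i, `|x 0 i| < r.
Proof.
move=> /compact_bounded[M [_ KM]]; exists (`|M| + 2).
  by rewrite ltr_wpDl// normr_ge0.
move=> x Kx i; apply: (@le_lt_trans _ _ (`|M| + 1)); last by rewrite ltrD2l ltr1n.
apply: (le_trans (coord_le_mx_norm x i)).
by apply: (KM _ _ x Kx); rewrite (le_lt_trans (ler_norm M))// ltrDl.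
Qed.

Lemma C0inf_continuous (f : 'rV[R]_n -> R) : C0inf f -> continuous f.
Proof. by move=> [/(_ [::])[]]. Qed.

Lemma C0inf_measurable (f : 'rV[R]_n -> R) : C0inf f -> measurable_fun setT f.
Proof. by move/C0inf_continuous/continuous_measurable_row. Qed.

Lemma C0inf_bounded (f : 'rV[R]_n -> R) : C0inf f ->
  exists2 M : R, 0 < M & forall x, `|f x| <= M.
Proof.
move=> f0; have cf := C0inf_continuous f0; have [_ [K [cK fK]]] := f0.
have : compact (f @` K) by apply: continuous_compact => //; exact: continuous_subspaceT.
move=> /compact_bounded[M [_ fM]]; exists (`|M| + 1) => [|x]; first by rewrite ltr_wpDl.
have [Kx|/fK ->] := pselect (K x); last by rewrite normr0 addr_ge0.
by apply: (fM _ _ (f x)); [rewrite (le_lt_trans (ler_norm M))// ltrDl|exists x].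
Qed.

(** For t > 0 every level set lies in the compact support, hence in one fixed box. *)
Lemma C0inf_levelset (f : 'rV[R]_n -> R) : C0inf f ->
  exists2 V : R, 0 <= V & forall t, 0 < t -> (mu (levelset f t) <= V%:E)%E.
Proof.
move=> f0; have [_ [K [/compact_coord_bounded[r r0 Kr] fK]]] := f0.
have rr : - r <= r by rewrite (@le_trans _ _ 0) ?oppr_le0 ?(ltW r0).
exists ((r - - r) ^+ n) => [|t t0]; first by rewrite exprn_ge0// subr_ge0.
rewrite -rowmeasure_box//; apply: le_measure; rewrite ?inE.
- by apply: measurable_levelset; exact: C0inf_measurable.
- exact: measurable_box.
move=> x /= tfx i; have /Kr/(_ i) : K x.
  by apply: contrapT => /fK fx; move: tfx; rewrite /levelset/= fx normr0 ltNge (ltW t0).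
by rewrite ltr_norml => /andP[-> /ltW].
Qed.

Lemma distr_ni (f : 'rV[R]_n -> R) : C0inf f ->
  forall s t, 0 < s -> s <= t -> distr f t <= distr f s.
Proof.
move=> f0 s t s0 st; have [V V0 fV] := C0inf_levelset f0.
have mf := C0inf_measurable f0.
apply: fine_le; rewrite ?ge0_fin_numE// ?(le_lt_trans (fV _ _)) ?ltry//.
  exact: lt_le_trans st.
apply: le_measure; rewrite ?inE; [exact: measurable_levelset..|].
by move=> x; rewrite /levelset/=; exact: le_lt_trans.
Qed.

Lemma distr_eq0 (f : 'rV[R]_n -> R) (M t : R) : (forall x, `|f x| <= M) -> M <= t ->
  distr f t = 0.
Proof.
move=> fM Mt; rewrite /distr (_ : levelset f t = set0) ?measure0//.
by apply/seteqP; split=> // x; rewrite /levelset/= ltNge (le_trans (fM x) Mt).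
Qed.

Lemma distrE (f : 'rV[R]_n -> R) t : C0inf f -> 0 < t ->
  mu (levelset f t) = (distr f t)%:E.
Proof.
move=> f0 t0; have [V _ fV] := C0inf_levelset f0.
by rewrite /distr fineK// ge0_fin_numE// (le_lt_trans (fV _ t0)) ?ltry.
Qed.

End TestFunctions.

Section BesovEnergy.
Context (R : realType) (n : nat).
Local Notation mu := (rowmeasure R n).

(** The p-th power of the Besov norm for q = p and first differences, with the kernel inside the
    inner integral so that Tonelli applies. *)
Definition besov_energy (p beta : R) (f : 'rV[R]_n -> R) : \bar R :=
  (\int[mu]_h \int[mu]_x (`|f (x + h)%R - f x| `^ p * enorm h `^ (- (n%:R + p * beta)))%:E)%E.

Lemma besov_energy_ge0 p beta f : (0 <= besov_energy p beta f)%E.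
Proof.
apply: integral_ge0 => h _; apply: integral_ge0 => x _.
by rewrite lee_fin mulr_ge0 ?powR_ge0.
Qed.

Lemma besovE (p beta : R) (f : 'rV[R]_n -> R) : 0 < p -> 0 < beta < 1 ->
  measurable_fun setT f ->
  besov p p beta f = poweR (besov_energy p beta f) p^-1.
Proof.
move=> p0 /andP[b0 b1] mf; rewrite /besov.
(* For beta in ]0, 1[ the norm involves first differences only. *)
have -> : `|(Num.floor beta + 1)%R|%N = 1%N.
  by rewrite (floor_def (m := 0)) ?add0r ?ltW.
congr (poweR _ _); rewrite /besov_energy.
pose F (z : 'rV[R]_n * 'rV[R]_n) : \bar R := (`|f (z.2 + z.1) - f z.2| `^ p)%:E.
have F0 z : (0 <= F z)%E by rewrite lee_fin powR_ge0.
have mF : measurable_fun setT F.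
  apply/measurable_EFinP; apply: (measurableT_comp (@measurable_powR R _)).
  apply: (measurableT_comp (@normr_measurable R setT)); apply: measurable_funB.
    exact: measurable_fun_addrow.
  exact: measurableT_comp.
have mFh h : measurable_fun setT (fun x => F (h, x)).
  by apply: (measurableT_comp mF).
have mK : measurable_fun setT (fun h : 'rV[R]_n => (enorm h `^ (- (n%:R + p * beta)))%:E).
  apply/measurable_EFinP; apply: (measurableT_comp (@measurable_powR R _)).
  exact: measurable_enorm.
(* As q = p, the outer power cancels the root in the L^p norm. *)
have e h : (poweR (Lpnorm p (Delta 1 h f)) p * (enorm h `^ (- (n%:R + beta * p)))%:E =
    (\int[mu]_x F (h, x)) * (enorm h `^ (- (n%:R + p * beta)))%:E)%E.
  rewrite /Lpnorm -poweRrM mulVf ?gt_eqF// [beta * p]mulrC; congr (_ * _)%E.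
  have iE : iint (fun x => (`|Delta 1 h f x| `^ p)%:E) = (\int[mu]_x F (h, x))%E.
    exact: (iintE (mFh h) (fun x => F0 _)).
  by rewrite iE poweRe1//; apply: integral_ge0.
transitivity (iint (fun h : 'rV[R]_n => (\int[mu]_x F (h, x)) *
    (enorm h `^ (- (n%:R + p * beta)))%:E)%E);
  first by apply: (congr1 (@iint R n)); apply/funext => h; exact: e.
rewrite iintE.
- apply: eq_integral => h _; rewrite -ge0_integralZr//.
  by rewrite lee_fin powR_ge0.
- by apply: emeasurable_funM => //; exact: (measurable_fun_fubini_tonelli_F F).
- by move=> h; apply: mule_ge0; [apply: integral_ge0|rewrite lee_fin powR_ge0].
Qed.

End BesovEnergy.

Lemma iint_ge0 (R : realType) n (f : 'rV[R]_n -> \bar R) :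
  (forall x, 0 <= f x)%E -> (0 <= iint f)%E.
Proof.
elim: n f => [|n IH] f f0 /=; first exact: f0.
by apply: integral_ge0 => x _; apply: IH.
Qed.

(** * The four inequalities *)

Section Inequalities.
Context (R : realType) (n : nat) (beta p : R).
Hypotheses (b0 : 0 < beta) (b1 : beta < 1) (p1 : 1 <= p) (pbn : p * beta < n%:R).
Local Notation mu := (rowmeasure R n).
Local Notation leb := (@lebesgue_measure R).
Local Notation th := (p * beta / n%:R).

Let p0 : 0 < p. Proof. exact: lt_le_trans ltr01 p1. Qed.
Let pb0 : 0 < p * beta. Proof. exact: mulr_gt0. Qed.
Let nR0 : 0 < n%:R :> R. Proof. exact: lt_trans pbn. Qed.
Let n0 : (0 < n)%N. Proof. by rewrite -(ltr0n R). Qed.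
Let th0 : 0 < th. Proof. exact: divr_gt0. Qed.
Let th1 : th < 1. Proof. by rewrite ltr_pdivrMr// mul1r. Qed.

(** The integral of (1), written with the real-valued distribution function. *)
Definition level_integral (f : 'rV[R]_n -> R) : \bar R :=
  (\int[leb]_(t in `]0%R, +oo[) (distr f t `^ (1 - th) * (p * t `^ (p - 1)))%:E)%E.

Lemma level_integral_ge0 f : (0 <= level_integral f)%E.
Proof.
by apply: integral_ge0 => t _; rewrite lee_fin !mulr_ge0 ?powR_ge0 ?(ltW p0).
Qed.

Lemma measurable_level_integrand (f : 'rV[R]_n -> R) : C0inf f ->
  measurable_fun setT (fun t => distr f t `^ (1 - th) * (p * t `^ (p - 1))).
Proof.
move=> /C0inf_measurable/measurable_distr mD; apply: measurable_funM.
  exact: (measurableT_comp (@measurable_powR R _)).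
exact: measurable_funM.
Qed.

Lemma level_integralZ f (k : R) : C0inf f -> 0 <= k ->
  (k%:E * level_integral f = \int[leb]_(t in `]0%R, +oo[)
    (k * (distr f t `^ (1 - th) * (p * t `^ (p - 1))))%:E)%E.
Proof.
move=> f0 k0; rewrite /level_integral -ge0_integralZl//.
- by apply/measurable_EFinP/measurable_funTS; exact: measurable_level_integrand.
- by move=> t _; rewrite lee_fin !mulr_ge0 ?powR_ge0 ?(ltW p0).
Qed.

Lemma level_integral_lty f : C0inf f -> (level_integral f < +oo)%E.
Proof.
move=> f0; have [V V0 fV] := C0inf_levelset f0; have [M M0 fM] := C0inf_bounded f0.
apply: (weight_integral_lty p1 th1 (distr_ge0 f) _ M0 (fun t => distr_eq0 fM)) => t t0.
by rewrite -lee_fin -(distrE f0 t0); exact: fV.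
Qed.

(** The doubling estimate bounds the integral by [J], and the energy bound with s = p beta controls
    [J]; the constant is the quotient of the two. *)
Lemma level_integral_le : exists2 C : R, 0 < C &
  forall f, C0inf f -> (level_integral f <= C%:E * besov_energy p beta f)%E.
Proof.
have [c c0 energy] := energy_ge n0 p1 pb0.
have dbl f (f0 : C0inf f) := weight_integral_doubling p1 th0 th1 (distr_ge0 f)
  (measurable_distr (C0inf_measurable f0)) (distr_ni f0) (level_integral_lty f0).
set K := 2 * _ in dbl.
exists (K / c) => [|f f0]; first by rewrite divr_gt0// !mulr_gt0 ?powR_gt0.
have ffin t : 0 < t -> (mu (levelset f t) < +oo)%E.
  by move=> t0; rewrite (distrE f0 t0) ltry.
have := energy f (C0inf_measurable f0) ffin => /(lee_wpmul2l (_ : 0 <= (K / c)%:E)%E) H.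
apply: le_trans (dbl f f0) (le_trans _ (H _)).
  by rewrite muleA -EFinM divfK ?gt_eqF.
by rewrite lee_fin divr_ge0 ?(ltW c0)// !mulr_ge0 ?powR_ge0.
Qed.

Lemma level_integral_besov : exists2 C : R, 0 < C &
  forall f, C0inf f -> (poweR (level_integral f) p^-1 <= C%:E * besov p p beta f)%E.
Proof.
have [C C0 le_energy] := level_integral_le.
exists (C `^ p^-1) => [|f f0]; first exact: powR_gt0.
rewrite besovE ?b0//; last exact: C0inf_measurable.
rewrite -poweR_EFin -poweRM ?lee_fin ?(ltW C0) ?besov_energy_ge0//.
apply: gt0_ler_poweR; rewrite ?invr_ge0 ?(ltW p0) ?in_itv/= ?leey ?andbT//.
- exact: level_integral_ge0.
- by rewrite mule_ge0 ?besov_energy_ge0 ?lee_fin ?(ltW C0).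
- exact: le_energy.
Qed.

(** With q = p/(1-th) and r = th/(1-th), the weak-type bound gives a q-th power integral of order
    A^(1+r). Since (1 + r)/q = 1/p, the q-th root is of order A^(1/p). *)
Lemma sobolev_le_level_integral : exists2 C : R, 0 < C & forall f, C0inf f ->
  (poweR (iint (fun x => (`|f x| `^ (p / (1 - th)))%:E)) ((1 - th) / p) <=
   C%:E * poweR (level_integral f) p^-1)%E.
Proof.
have th1' : 0 < 1 - th by rewrite subr_gt0.
pose q := p / (1 - th); pose r := th / (1 - th).
have q1 : 1 <= q.
  by rewrite /q ler_pdivlMr// mul1r (le_trans _ p1)// gerBl ltW.
have q0 : 0 < q by exact: lt_le_trans q1.
have r0 : 0 <= r by rewrite divr_ge0 ?(ltW th0) ?(ltW th1').
(* The factor 2^q comes from the layer cake formula, (2^p)^r from the weak-type bound. *)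
pose K := 2 `^ q * (2 `^ p) `^ r; have K0 : 0 < K by rewrite mulr_gt0 ?powR_gt0.
exists (K `^ q^-1) => [|f f0]; first exact: powR_gt0.
have mf := C0inf_measurable f0.
have Afin : level_integral f \is a fin_num.
  by rewrite ge0_fin_numE ?level_integral_ge0 ?level_integral_lty.
set A := fine (level_integral f); have AE : level_integral f = A%:E by rewrite fineK.
have A0 : 0 <= A by rewrite fine_ge0 ?level_integral_ge0.
have le1 : (iint (fun x => (`|f x| `^ q)%:E) <= (K * A `^ (1 + r))%:E)%E.
  have mq : measurable_fun setT (fun x => `|f x| `^ q).
    apply: (measurableT_comp (@measurable_powR R _)).
    exact: (measurableT_comp (@normr_measurable R setT)).
  rewrite iintE; [|exact/measurable_EFinP|by move=> x; rewrite lee_fin powR_ge0].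
  have cake := layer_cake mu mf (@measurable_cst _ _ _ _ setT (1 : R)) (fun=> ler01) q1.
  under eq_integral do rewrite -[X in X%:E]mulr1.
  apply: (le_trans cake); rewrite -[X in (_ <= X)%E]EFinM.
  have wk : (\int[leb]_(t in `]0%R, +oo[) (t `^ (q - 1) * distr f t)%:E <=
      ((2 `^ p * A) `^ r)%:E * level_integral f)%E.
    have A20 : 0 <= 2 `^ p * A by rewrite mulr_ge0 ?powR_ge0.
    have wkt t : 0 < t -> t `^ p * distr f t `^ (1 - th) <= 2 `^ p * A.
      move=> t0; rewrite -lee_fin [X in (_ <= X)%E]EFinM -AE.
      exact: (weight_integral_ge p1 th1 (distr_ge0 f) (distr_ni f0) t0).
    apply: (le_trans (weak_type_integral_le p1 th0 th1 (distr_ge0 f) A20 wkt)).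
    by rewrite level_integralZ// powR_ge0.
  apply: (@le_trans _ _ ((2 `^ q)%:E * (((2 `^ p * A) `^ r)%:E * level_integral f))%E).
    apply: lee_wpmul2l; first by rewrite lee_fin powR_ge0.
    apply: le_trans wk; apply: ge0_le_integral_nonmeas => t /=.
      by move=> _; apply: mule_ge0; [rewrite lee_fin powR_ge0|exact: integral_ge0].
    rewrite in_itv/= andbT => t0; rewrite integral_cst; last exact: measurable_levelset.
    by rewrite mul1e EFinM; apply: lee_wpmul2l; [rewrite lee_fin powR_ge0|rewrite -(distrE f0 t0)].
  rewrite AE -!EFinM lee_fin powRM ?powR_ge0// /K powRD; last first.
    by apply/implyP; rewrite gt_eqF// ltr_pwDl.
  by rewrite powRr1// le_eqVlt; apply/orP; left; apply/eqP; ring.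
have -> : (1 - th) / p = q^-1 by rewrite /q invf_div.
apply: (@le_trans _ _ (poweR (K * A `^ (1 + r))%:E q^-1)).
  apply: gt0_ler_poweR; rewrite ?invr_ge0 ?(ltW q0) ?in_itv/= ?leey ?andbT//.
  - by apply: iint_ge0 => x; rewrite lee_fin powR_ge0.
  - by rewrite lee_fin mulr_ge0 ?powR_ge0 ?(ltW K0).
rewrite AE !poweR_EFin -EFinM lee_fin powRM ?(ltW K0) ?powR_ge0// -powRrM.
have y0 : 1 - th != 0 by rewrite gt_eqF.
have pn0 : p != 0 by rewrite gt_eqF.
rewrite (_ : (1 + r) / q = p^-1)// /r /q.
by move: (p * beta / n%:R) y0 => y y0; field; rewrite pn0.
Qed.

(** The layer cake formula with weight |x|^-(p beta) reduces the claim to the integral of this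
    weight over each level set, where the bathtub inequality applies. *)
Lemma hardy_le_level_integral : exists2 C : R, 0 < C & forall f, C0inf f ->
  (poweR (iint (fun x => (`|f x| `^ p / enorm x `^ (p * beta))%:E)) p^-1 <=
   C%:E * poweR (level_integral f) p^-1)%E.
Proof.
have [C C0 bathtub] := riesz_bathtub n0 pb0 pbn.
pose K := 2 `^ p * C; have K0 : 0 < K by rewrite mulr_gt0 ?powR_gt0.
exists (K `^ p^-1) => [|f f0]; first exact: powR_gt0.
have mf := C0inf_measurable f0.
pose W (x : 'rV[R]_n) := (enorm x `^ (p * beta))^-1.
have W0 x : 0 <= W x by rewrite invr_ge0 powR_ge0.
have mW : measurable_fun setT W.
  rewrite (_ : W = fun x => enorm x `^ (- (p * beta))); last first.
    by apply/funext => x; rewrite powRN.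
  by apply: (measurableT_comp (@measurable_powR R _)); exact: measurable_enorm.
have mfW : measurable_fun setT (fun x => `|f x| `^ p * W x).
  apply: measurable_funM => //; apply: (measurableT_comp (@measurable_powR R _)).
  exact: (measurableT_comp (@normr_measurable R setT)).
have le1 : (iint (fun x => (`|f x| `^ p * W x)%:E) <= K%:E * level_integral f)%E.
  rewrite iintE; [|exact/measurable_EFinP|by move=> x; rewrite lee_fin mulr_ge0 ?powR_ge0].
  apply: (le_trans (layer_cake mu mf mW W0 p1)).
  rewrite EFinM -muleA; apply: lee_wpmul2l; first by rewrite lee_fin powR_ge0.
  rewrite level_integralZ ?(ltW C0)//; apply: ge0_le_integral_nonmeas => t /=.
    move=> _; apply: mule_ge0; first by rewrite lee_fin powR_ge0.
    by apply: integral_ge0 => x _; rewrite lee_fin.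
  rewrite in_itv/= andbT => t0.
  have Et : (mu (levelset f t) < +oo)%E by rewrite (distrE f0 t0) ltry.
  apply: (@le_trans _ _ ((t `^ (p - 1))%:E * (C * distr f t `^ (1 - th))%:E)%E).
    apply: lee_wpmul2l; first by rewrite lee_fin powR_ge0.
    exact: bathtub (measurable_levelset t mf) Et.
  rewrite -EFinM lee_fin mulrCA; apply: ler_wpM2l; first exact: ltW.
  rewrite mulrC.
  by apply: ler_wpM2l; rewrite ?powR_ge0// ler_peMl ?powR_ge0.
rewrite -poweR_EFin -poweRM ?lee_fin ?(ltW K0) ?level_integral_ge0//.
apply: gt0_ler_poweR; rewrite ?invr_ge0 ?(ltW p0) ?in_itv/= ?leey ?andbT//.
- by apply: iint_ge0 => x; rewrite lee_fin mulr_ge0 ?powR_ge0 ?invr_ge0 ?powR_ge0.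
- by rewrite mule_ge0 ?level_integral_ge0 ?lee_fin ?(ltW K0).
Qed.

End Inequalities.

(** * Volume and capacity of bounded smooth domains *)

Section Capacity.
Context (R : realType) (n : nat).

Lemma le_iint m (f g : 'rV[R]_m -> \bar R) : (forall x, 0 <= f x)%E ->
  (forall x, f x <= g x)%E -> (iint f <= iint g)%E.
Proof.
elim: m f g => [|m IH] f g f0 fg /=; first exact: fg.
apply: ge0_le_integral_nonmeas => x _; last exact: IH.
exact: iint_ge0.
Qed.

Lemma mx_norm_le_enorm (x : 'rV[R]_n) : `|x| <= enorm x.
Proof.
have [->|x0] := eqVneq (`|x|) 0; first exact: enorm_ge0.
have [[i j] /= xij] := mx_norm_neq0 x0.
by rewrite [leLHS]xij (ord1 i) enorm_ge_coord.
Qed.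

Lemma compact_closure_enorm (O : set 'rV[R]_n) (M : R) :
  (forall x, O x -> enorm x <= M) -> compact (closure O).
Proof.
move=> OM; apply: bounded_closed_compact; last exact: closed_closure.
(* A point of the closure is within distance 1 of [O], and the sup norm is dominated by the
   Euclidean one. *)
exists (M + 1); split; first exact: num_real.
move=> r Mr x cOx.
have [y [Oy /= yx]] := cOx _ (nbhsx_ballx x (1 : R) ltr01).
have xy : `|x - y| < 1 by move: yx; rewrite -ball_normE.
rewrite -(subrK y x) (le_trans (ler_normD _ _))//.
by have := OM _ Oy; have := mx_norm_le_enorm y; lra.
Qed.

(** A function that is at least 1 on the closure of [O] satisfies vol(O) <= int |f|^q, so a Sobolev
    bound controls the volume by its norm. The constant becomes C^p because the capacity is built
    from p-th powers of norms. *)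
Lemma vol_le_cap (p beta e C : R) (q : R) (O : set 'rV[R]_n) :
  0 < p -> 0 < e -> 0 <= q -> 0 < C -> smooth_bounded_domain O ->
  (forall f : 'rV[R]_n -> R, C0inf f ->
    poweR (iint (fun x => (`|f x| `^ q)%:E)) (e / p) <= C%:E * besov p p beta f)%E ->
  (poweR (vol O) e <= (C `^ p)%:E * cap p p beta (closure O))%E.
Proof.
move=> p0 e0 q0 C0 [_ _ _ [M OM] _] sobolev.
have vol0 : (0 <= vol O)%E by apply: iint_ge0 => x; rewrite lee_fin.
rewrite -lee_pdivrMl ?powR_gt0//; apply: le_ereal_inf_tmp => _ [U [oU OU] <-].
apply: (@le_trans _ _ (capK p p beta (closure O))); last first.
  (* The closure of [O] is itself an admissible compact set inside every open [U] containing it. *)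
  by apply: ereal_sup_ubound; exists (closure O); split=> //; exact: compact_closure_enorm OM.
apply: le_ereal_inf_tmp => _ [f [f0 f1] <-]; rewrite lee_pdivrMl ?powR_gt0//.
have besov0 : (0 <= besov p p beta f)%E by exact: poweR_ge0.
rewrite -poweR_EFin -poweRM ?lee_fin ?(ltW C0)//.
have -> : poweR (vol O) e = poweR (poweR (vol O) (e / p)) p.
  by rewrite -poweRrM divfK ?gt_eqF.
apply: gt0_ler_poweR; rewrite ?(ltW p0) ?in_itv/= ?leey ?andbT ?poweR_ge0//.
  by rewrite mule_ge0 ?lee_fin ?(ltW C0).
apply: le_trans (sobolev f f0); apply: gt0_ler_poweR;
  rewrite ?divr_ge0 ?(ltW e0) ?(ltW p0) ?in_itv/= ?leey ?andbT//.
  by apply: iint_ge0 => x; rewrite lee_fin powR_ge0.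
apply: le_iint => x; first by rewrite lee_fin.
rewrite lee_fin indicE; have [Ox|Ox] := pselect (O x); last by rewrite memNset// powR_ge0.
rewrite mem_set//.
have fx1 : 1 <= f x.
  by have := f1 x; rewrite indicE mem_set//; exact: subset_closure.
apply: (@le_trans _ _ (1 `^ q)); first by rewrite powR1.
by rewrite ge0_ler_powR ?nnegrE// (le_trans fx1)// ler_norm.
Qed.
End Capacity.
Theorem theorem3p2 (R : realType) (n : nat) (beta p : R) :
  0 < beta < 1 -> 1 <= p -> p < n%:R / beta ->
  let S1 := exists C : R, 0 < C /\ forall f : 'rV[R]_n -> R, C0inf f ->
      (poweR (\int[@lebesgue_measure R]_(t in `]0%R, +oo[%classic)
          (poweR (vol (levelset f t)) ((n%:R - p * beta) / n%:R)
           * (p * t `^ (p - 1))%:E))%E p^-1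
       <= C%:E * besov p p beta f)%E in
  let S2 := exists C : R, 0 < C /\ forall f : 'rV[R]_n -> R, C0inf f ->
      (poweR (iint (fun x => ((`|f x|) `^ (n%:R * p / (n%:R - p * beta)))%:E))
             ((n%:R - p * beta) / (n%:R * p))
       <= C%:E * besov p p beta f)%E in
  let S3 := exists C : R, 0 < C /\ forall f : 'rV[R]_n -> R, C0inf f ->
      (poweR (iint (fun x => ((`|f x|) `^ p / (enorm x) `^ (p * beta))%:E)) p^-1
       <= C%:E * besov p p beta f)%E in
  let S4 := exists C : R, 0 < C /\ forall O : set 'rV[R]_n,
      smooth_bounded_domain O ->
      (poweR (vol O) ((n%:R - p * beta) / n%:R)
       <= C%:E * cap p p beta (closure O))%E in
  [/\ S1 <-> S2, S2 <-> S3, S3 <-> S4 & [/\ S1, S2, S3 & S4]].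
Proof.
move=> /andP[b0 b1] p1 pnb S1 S2 S3 S4.
have p0 : 0 < p by exact: lt_le_trans p1.
have pbn : p * beta < n%:R by rewrite -ltr_pdivlMr.
have pb0 : 0 < p * beta by exact: mulr_gt0.
have n0 : n%:R != 0 :> R by rewrite gt_eqF// (lt_trans pb0).
pose th := p * beta / n%:R.
have e1 : (n%:R - p * beta) / n%:R = 1 - th by rewrite mulrBl divff.
have d0 : n%:R - p * beta != 0 by rewrite gt_eqF// subr_gt0.
have th1 : 0 < 1 - th by rewrite -e1 divr_gt0 ?subr_gt0// (lt_trans pb0).
have e2 : n%:R * p / (n%:R - p * beta) = p / (1 - th).
  by rewrite -e1 invf_div mulrA [p * n%:R]mulrC.
have e3 : (n%:R - p * beta) / (n%:R * p) = (1 - th) / p by rewrite -e1 invfM mulrA.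
have [C0 C00 lvl] := level_integral_besov b0 b1 p1 pbn.
(* Any bound by the integral of (1) becomes a Besov bound, with the constants multiplied. *)
have main (I : ('rV[R]_n -> R) -> \bar R) :
    (exists2 C, 0 < C & forall f, C0inf f ->
      (I f <= C%:E * poweR (level_integral beta p f) p^-1)%E) ->
    exists C, 0 < C /\ forall f, C0inf f -> (I f <= C%:E * besov p p beta f)%E.
  move=> [C Cp IC]; exists (C * C0); split=> [|f f0]; first exact: mulr_gt0.
  apply: (le_trans (IC f f0)); rewrite EFinM -muleA.
  by apply: lee_wpmul2l; [rewrite lee_fin ltW|exact: lvl].
have H1 : S1.
  exists C0; split=> // f f0; apply: le_trans (lvl f f0).
  rewrite (_ : (\int[_]_(t in _) _)%E = level_integral beta p f)//.
  (* Only levels t > 0 occur, where the volume is finite and agrees with [distr]. *)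
  apply: eq_integral => t; rewrite inE/= in_itv/= andbT => t0.
  rewrite e1 volE; last by apply: measurable_levelset; exact: C0inf_measurable.
  by rewrite (distrE f0 t0) poweR_EFin -EFinM.
have H2 : S2.
  by rewrite /S2 e2 e3; apply: main; exact: sobolev_le_level_integral.
have H3 : S3 by apply: main; exact: hardy_le_level_integral.
have H4 : S4.
  have [C [Cp sob]] := H2.
  exists (C `^ p); split=> [|O smO]; first exact: powR_gt0.
  rewrite e1; apply: (vol_le_cap p0 th1 _ Cp smO (q := p / (1 - th))) => [|f f0].
    by rewrite divr_ge0 ?(ltW p0) ?(ltW th1).
  by rewrite -e3 -e2; exact: sob.
(* Each equivalence holds because both of its sides have been proved. *)
by split.
Qed.
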